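(* For any set $X\subseteq2^\omega$, the following are equivalent: (i) $X$ is $\overline{\mathcal H}$-null; (ii) $X$ is $\mathcal M$-additive; (iii) $X$ is $\mathcal E$-additive; (iv) $X$ is sharply $\mathcal M$-additive; (v) $X$ is sharply $\mathcal E$-additive; (vi) $X$ is sharply null.
   Context: $2^\omega$ is the Cantor cube, a compact group under coordinatewise addition mod 2, with metric $d(x,y)=2^{-n(x,y)}$ for $x\neq y$, where $n(x,y)=\min\{i:x(i)\ne y(i)\}$; $\mu$ is its Haar (= product) measure. $\mathcal M$ is the ideal of meager subsets of $2^\omega$; $\mathcal E$ is the $\sigma$-ideal generated by closed $\mu$-null sets. $A+B=\{a+b:a\in A,b\in B\}$. For an ideal $\mathcal J$ on $2^\omega$, a set $X\subseteq 2^\omega$ is $\mathcal J$-additive if $X+J\in\mathcal J$ for every $J\in\mathcal J$; it is sharply $\mathcal J$-additive if for every $J\in\mathcal J$ there is a $\sigma$-compact set $F\supseteq X$ (in $2^\omega$) such that $F+J\in\mathcal J$. $X$ is sharply null if for each $M\in\mathcal M$ there is a $\sigma$-compact $F\supseteq X$ such that $F+M\ne2^\omega$. For a metric space $X$ with completion $X^\star$, the upper Hausdorff dimension is $\overline{\dim}_H X=\inf\{\dim_H K: K\ \sigma\text{-compact},\ X\subseteq K\subseteq X^\star\}$, with $\dim_H$ Hausdorff dimension and $\inf\emptyset=\infty$. A separable metric space $X$ is $\overline{\mathcal H}$-null if $\overline{\dim}_H f(X)=0$ for every uniformly continuous map $f$ from $X$ into a metric space. Subsets of $2^\omega$ carry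 the metric inherited from $2^\omega$. *)

(* Defs.v *)
From HB Require Import structures.
From mathcomp Require Import all_boot all_order all_algebra finmap.
From mathcomp Require Import all_classical all_reals all_analysis.
From mathcomp Require Import ring lra zify.

Set Implicit Arguments.
Unset Strict Implicit.
Unset Printing Implicit Defensive.

Import Order.TTheory GRing.Theory Num.Theory.
Import numFieldNormedType.Exports.

Local Open Scope classical_set_scope.
Local Open Scope ring_scope.

Section cantor_group.
Implicit Types x y z : cantor_space.

Definition cantor_add x y : cantor_space := fun n => x n (+) y n.
Definition cantor_zero : cantor_space := fun=> false.

Let cantor_addA : associative cantor_add.
Proof. by move=> x y z; apply/funext => n; exact: addbA. Qed.
Let cantor_addC : commutative cantor_add.
Proof. by move=> x y; apply/funext => n; exact: addbC. Qed.
Let cantor_add0 : left_id cantor_zero cantor_add.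
Proof. by move=> x; apply/funext => n. Qed.
Let cantor_addN : left_inverse cantor_zero id cantor_add.
Proof. by move=> x; apply/funext => n; exact: addbb. Qed.

HB.instance Definition _ := GRing.isZmodule.Build cantor_space
  cantor_addA cantor_addC cantor_add0 cantor_addN.

End cantor_group.

Section cantor_metric.
Context {R : realType}.
Implicit Types x y z : cantor_space.

Definition cantor_dist x y : R :=
  if pselect (exists n, x n != y n) is left xy then 2^-1 ^+ ex_minn xy else 0.

Definition agree (n : nat) x y := forall i, (i < n)%N -> x i = y i.

Lemma cantor_dist_lt n x y : cantor_dist x y < 2^-1 ^+ n <-> agree n.+1 x y.
Proof.
rewrite /cantor_dist; case: pselect => [xy|xy]; last first.
  split=> [_ i _|_]; last by rewrite exprn_gt0.
  by apply/eqP/negPn/negP => h; apply: xy; exists i.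
case: ex_minnP => m xm mmin.
rewrite ltr_iXn2l ?invr_gt0// ?invf_lt1// ?ltr1n//.
split=> [nm i|ag].
  rewrite ltnS => le_in; apply/eqP/negPn/negP => /mmin; rewrite leqNgt => /negP.
  by apply; exact: leq_ltn_trans nm.
rewrite ltnNge; apply/negP => mn; move/eqP: xm; apply; exact: ag.
Qed.

Lemma agreeP x y : (forall n, agree n x y) -> x = y.
Proof. by move=> ag; apply/funext => n; exact: (ag n.+1). Qed.

Lemma cantor_dist_ge0 x y : 0 <= cantor_dist x y.
Proof. by rewrite /cantor_dist; case: pselect => // ?; rewrite exprn_ge0. Qed.

Lemma cantor_distxx x : cantor_dist x x = 0.
Proof.
by rewrite /cantor_dist; case: pselect => // xx; exfalso; move: xx => [n /eqP].
Qed.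

Lemma cantor_dist_eq0 x y : cantor_dist x y = 0 -> x = y.
Proof.
move=> xy0; apply: agreeP => -[//|n]; apply/cantor_dist_lt.
by rewrite xy0 exprn_gt0.
Qed.

Lemma cantor_distC x y : cantor_dist x y = cantor_dist y x.
Proof.
have le z t : cantor_dist z t <= cantor_dist t z.
  rewrite {2}/cantor_dist; case: pselect => [tz|tz]; last first.
    rewrite /cantor_dist; case: pselect => // zt; exfalso; apply: tz.
    by case: zt => n; rewrite eq_sym => ?; exists n.
  case: ex_minnP => m tzm mmin; case: m tzm mmin => [|m] tzm mmin.
    rewrite expr0 /cantor_dist; case: pselect => // zt.
    by rewrite exprn_ile1// invf_le1// ler1n.
  rewrite /cantor_dist; case: pselect => [zt|_]; last by rewrite exprn_ge0.
  case: ex_minnP => k ztk _; rewrite ler_wiXn2l// ?invf_le1// ?ler1n//.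
  by apply: mmin; rewrite eq_sym.
by apply/eqP; rewrite eq_le !le.
Qed.

Lemma cantor_dist_ultra y x z :
  cantor_dist x z <= Num.max (cantor_dist x y) (cantor_dist y z).
Proof.
rewrite {1}/cantor_dist; case: pselect => [xz|_]; last first.
  by rewrite le_max cantor_dist_ge0.
case: ex_minnP => m xzm _; rewrite leNgt; apply/negP; rewrite gt_max => /andP[].
move=> /cantor_dist_lt xy /cantor_dist_lt yz; move/eqP: xzm; apply.
by rewrite xy// yz.
Qed.

Let cantor_ball x (e : R) : set cantor_space := [set y | cantor_dist x y < e].

Let cantor_ball_center x (e : R) : 0 < e -> cantor_ball x e x.
Proof. by rewrite /cantor_ball/= cantor_distxx. Qed.

Let cantor_ball_sym x y (e : R) : cantor_ball x e y -> cantor_ball y e x.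
Proof. by rewrite /cantor_ball/= cantor_distC. Qed.

Let cantor_ball_triangle x y z (e1 e2 : R) :
  cantor_ball x e1 y -> cantor_ball y e2 z -> cantor_ball x (e1 + e2) z.
Proof.
rewrite /cantor_ball/= => xy yz; apply: le_lt_trans (ltrD xy yz).
apply: le_trans (cantor_dist_ultra y x z) _.
by rewrite ge_max lerDl lerDr !cantor_dist_ge0.
Qed.

Lemma entourage_agree n :
  entourage [set xy : cantor_space * cantor_space | agree n xy.1 xy.2].
Proof.
elim: n => [|n ih].
  by rewrite (_ : [set _ | _] = setT); [exact: entourageT|apply/seteqP; split].
have En : entourage [set xy : cantor_space * cantor_space | xy.1 n = xy.2 n].
  have Pn : `[< @entourage (initial_topology
      (@proj nat (fun=> bool) n)) [set xy | xy.1 n = xy.2 n] >].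
    apply/asboolP; exists (@diagonal bool).
      by rewrite uniform_discrete => _ [b _ <-]; apply/diagonalP.
    by move=> [x y] /diagonalP.
  exists [set xy | xy.1 n = xy.2 n] => //.
  exact: (@finI_from1 _ _ _ _ (exist _ (n : {classic nat}, _) Pn)).
apply: filterS (filterI ih En) => -[x y]/= [xy xyn] i.
by rewrite ltnS leq_eqVlt => /predU1P[->//|]; exact: xy.
Qed.

Let fset_ltn (I : choiceType) (J : {fset I}) (F : I -> nat) :
  exists n, forall p, p \in J -> (F p < n)%N.
Proof.
exists (\max_(p <- enum_fset J) (F p).+1)%N => p pJ.
exact: (@leq_bigmax_seq _ _ xpredT (fun p => (F p).+1) _ pJ isT).
Qed.

Lemma agree_entourage (E : set (cantor_space * cantor_space)) :
  entourage E -> exists n, [set xy | agree n xy.1 xy.2] `<=` E.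
Proof.
move=> [_ [J _ <-] JE].
have [N hN] := fset_ltn J (fun p => (projT1 p).1).
exists N => -[x y] /= xy; apply: JE => -[[n V] /= nV] /hN/= /xy xyn.
have [B entB] := asboolW nV; apply.
by have := @entourage_refl bool B (y n) entB; rewrite -{1}xyn.
Qed.

Let cantor_entourageE : entourage = entourage_ cantor_ball.
Proof.
apply/seteqP; split=> E.
  move=> /agree_entourage[n nE]; exists (2^-1 ^+ n) => /=.
    by rewrite exprn_gt0.
  move=> [x y] /cantor_dist_lt ag; apply: nE => i /= lt_in.
  by apply: ag; exact: ltnW.
move=> [e /= e0 eE].
have [n ne] : exists n, 2^-1 ^+ n < e :> R.
  have half1 : `|2^-1 : R| < 1 by rewrite ger0_norm ?invf_lt1// ltr1n.
  have [n _ /(_ n (leqnn n))/=] := @cvgr0_norm_lt _ _ _ _ _ (GRing.exp (2^-1 : R))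
    (cvg_expr half1) e e0.
  by rewrite ger0_norm ?exprn_ge0// => ?; exists n.
apply: filterS (entourage_agree n.+1) => -[x y] /= ag; apply: eE => /=.
by apply: lt_trans ne; exact/cantor_dist_lt.
Qed.

HB.instance Definition _ := Uniform_isPseudoMetric.Build R cantor_space
  cantor_ball_center cantor_ball_sym cantor_ball_triangle cantor_entourageE.

Let cantor_ballE x (d : R) : ball x d = [set y | cantor_dist x y < d].
Proof. by []. Qed.

HB.instance Definition _ := PseudoMetric_isMetric.Build R cantor_space
  cantor_dist_ge0 cantor_dist_eq0 cantor_ballE.

End cantor_metric.

Definition borel_cantor := g_sigma_algebraType (@open cantor_space).
HB.instance Definition _ := Measurable.on borel_cantor.

Definition cylinder (s : seq bool) : set cantor_space :=
  [set x | forall i, (i < size s)%N -> x i = nth false s i].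

Definition cylinders : set (set cantor_space) := set0 |` range cylinder.

Section cylinders.
Context {R : realType}.
Implicit Types s t : seq bool.

Lemma open_cylinder s : open (cylinder s).
Proof.
rewrite openE => x xs; rewrite /interior -(@nbhs_ballE R).
exists (2^-1 ^+ size s) => /=; first by rewrite exprn_gt0.
move=> y /cantor_dist_lt ag i si; rewrite -ag ?xs//.
exact: ltnW.
Qed.

Lemma open_cylinderP (A : set cantor_space) : open A ->
  A = \bigcup_(s in [set s | cylinder s `<=` A]) cylinder s.
Proof.
rewrite openE => oA; apply/seteqP; split => [x /oA|x [s /= + xs]]; last exact.
rewrite /interior -(@nbhs_ballE R) => -[e /= e0 eA].
have [E agE] := @agree_entourage [set xy | ball xy.1 e xy.2]
  (entourage_ball cantor_space (PosNum e0)).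
exists (mkseq x E); last first.
  by move=> i; rewrite size_mkseq => iE; rewrite nth_mkseq.
move=> y /= yx; apply: eA; apply: (agE (x, y)) => i /= iE.
by rewrite yx ?size_mkseq// nth_mkseq.
Qed.

Lemma borel_cylinders : @measurable _ borel_cantor = <<s cylinders >>.
Proof.
apply/seteqP; split; apply: smallest_sub.
- exact: smallest_sigma_algebra.
- move=> A /open_cylinderP ->.
  rewrite bigcup_mkcond.
  apply: (@countable_bigcupT_measurable _ (g_sigma_algebraType cylinders)).
    exact: countableP.
  move=> s; case: ifPn => _; last exact: measurable0.
  by apply: sub_gen_smallest; right; exists s.
- exact: smallest_sigma_algebra.
- move=> _ [->|[s _ <-]]; first exact: (@measurable0 _ borel_cantor).
  by apply: sub_gen_smallest; exact: open_cylinder.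
Qed.

Lemma cylindersI : setI_closed cylinders.
Proof.
have sub s t : (size s <= size t)%N ->
    cylinder t `&` cylinder s = set0 \/ cylinder t `&` cylinder s = cylinder t.
  move=> st; have [h|h] := pselect (forall i, (i < size s)%N ->
      nth false s i = nth false t i).
    right; apply/setIidPl => x xt i si; rewrite h// xt//.
    exact: leq_trans st.
  left; rewrite -subset0 => x [xt xs]; apply: h => i si.
  by rewrite -xs// xt//; exact: leq_trans st.
move=> A B [->|[s _ <-]]; first by rewrite set0I; left.
move=> [->|[t _ <-]]; first by rewrite setI0; left.
have [st|ts] := leqP (size s) (size t).
  rewrite setIC; have [->|->] := sub _ _ st; first by left.
  by right; exists t.
have [->|->] := sub _ _ (ltnW ts); first by left.
by right; exists s.
Qed.

(* the binary digits of x when x is in [0, 1[ *)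
Definition digits (x : R) : borel_cantor :=
  fun n => odd (Num.truncn (2 ^+ n.+1 * x)).

Definition cylinder_index s := foldl (fun k (b : bool) => k.*2 + b)%N 0%N s.

Lemma cylinder_index_lt s : (cylinder_index s < 2 ^ size s)%N.
Proof.
elim/last_ind: s => // s b; rewrite /cylinder_index foldl_rcons size_rcons.
by move: (foldl _ _ _) => k; rewrite expnS; case: b => /=; lia.
Qed.

Lemma truncn_half (y : R) : 0 <= y -> (Num.truncn (2 * y))./2 = Num.truncn y.
Proof.
move=> y0; apply/esym/eqP; rewrite truncn_eq//.
have /andP[] := truncn_itv (mulr_ge0 (ler0n R 2) y0).
set m := Num.truncn _ => my ym.
have := odd_double_half m; move: (m./2) => k mk.
rewrite -mk in my ym; move: my ym.
rewrite -addn1 !natrD -muln2 natrM => my ym.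
have b0 : 0 <= (odd m)%:R :> R by [].
have b1 : (odd m)%:R <= 1 :> R by case: (odd m).
rewrite -addn1 natrD; lra.
Qed.

Lemma digits_cylinder s (x : R) : x \in `[0, 1[ ->
  cylinder s (digits x) <-> Num.truncn (2 ^+ size s * x) = cylinder_index s.
Proof.
rewrite in_itv/= => /andP[x0 x1]; elim/last_ind: s => [|s b ih].
  rewrite expr0 mul1r; split=> // _.
  by apply/eqP; rewrite truncn_eq// x0 x1.
have half : (Num.truncn (2 ^+ size (rcons s b) * x))./2 =
    Num.truncn (2 ^+ size s * x).
  by rewrite size_rcons exprS -mulrA truncn_half// mulr_ge0.
rewrite /cylinder_index foldl_rcons -/(cylinder_index s).
move: ih half; rewrite size_rcons.
have -> : cylinder (rcons s b) (digits x) <->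
    cylinder s (digits x) /\ odd (Num.truncn (2 ^+ (size s).+1 * x)) = b.
  split=> [h|[h1 h2] i].
    split=> [i si|].
      by have := h i; rewrite size_rcons nth_rcons si ltnS (ltnW si); exact.
    by have := h (size s); rewrite size_rcons nth_rcons ltnn eqxx; exact.
  rewrite size_rcons nth_rcons ltnS leq_eqVlt => /predU1P[->|si].
    by rewrite ltnn eqxx.
  by rewrite si h1.
move=> -> <-; move: (Num.truncn (2 ^+ (size s).+1 * x)) => m.
have := odd_double_half m; move: (m./2) (odd m) => k c <-.
by split=> [[<- <-]|]; [rewrite addnC|case: c; case: b => /=; lia].
Qed.

Lemma measurable_digits : measurable_fun [set: R] digits.
Proof.
apply: (measurability _ borel_cylinders) => _ [_ [->|[s _ <-]] <-].
  by rewrite preimage_set0 setI0.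
rewrite setTI.
have -> : digits @^-1` cylinder s = \bigcap_(i < size s) \bigcup_(k in
   [set k | odd k = nth false s i])
   ([set x : R | x < 2^-1 ^+ i.+1 * k.+1%:R] `\`
     [set x : R | (0 < k)%N /\ x < 2^-1 ^+ i.+1 * k%:R]).
  apply/seteqP; split=> x /= h i si.
    exists (Num.truncn (2 ^+ i.+1 * x)); first by rewrite /= -h.
    split => /=.
      by rewrite exprVn mulrC ltr_pdivlMr ?exprn_gt0// mulrC truncnS_gt.
    move=> [k0]; rewrite exprVn mulrC ltr_pdivlMr ?exprn_gt0// mulrC.
    apply/negP; rewrite -leNgt truncn_le.
    by move: k0; rewrite truncn_gt0 => /(le_trans ler01).
  have [k /= <- [xk kx]] := h _ si.
  rewrite /digits; congr odd; apply/eqP; rewrite eqn_leq truncn_le_nat.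
  rewrite exprVn mulrC ltr_pdivlMr ?exprn_gt0// mulrC in xk; rewrite xk /=.
  case: k kx {xk} => // k kx; rewrite truncn_gt_nat leNgt; apply/negP => xk.
  by apply: kx; split=> //; rewrite exprVn mulrC ltr_pdivlMr ?exprn_gt0// mulrC.
apply: bigcap_measurableType => i _; apply: bigcup_measurable => // k _.
apply: measurableD.
  rewrite (_ : [set _ | _] = `]-oo, 2^-1 ^+ i.+1 * k.+1%:R[%classic).
    exact: measurable_itv.
  by apply/seteqP; split=> x /=; rewrite in_itv.
case: k => [|k].
  by rewrite (_ : [set _ | _] = set0)// -subset0 => x [].
rewrite (_ : [set _ | _] = `]-oo, 2^-1 ^+ i.+1 * k.+1%:R[%classic).
  exact: measurable_itv.
by apply/seteqP; split=> x /=; rewrite in_itv/= => -//[].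
Qed.

End cylinders.

Definition set_add (A B : set cantor_space) : set cantor_space :=
  [set a + b | a in A & b in B].

Definition is_haar (R : realType) (mu : probability borel_cantor R) : Prop :=
  forall (x : cantor_space) (A : set cantor_space),
    @measurable _ borel_cantor A -> mu (set_add [set x] A) = mu A.

Section haar.
Context {R : realType}.
Implicit Types (s : seq bool) (x y : cantor_space).

Let measurable_unit : measurable (`[0, 1[ : set R).
Proof. exact: measurable_itv. Qed.

(* the law of the binary digits of a uniform real number of [0, 1[ *)
Let coin : set borel_cantor -> \bar R :=
  pushforward (mrestr lebesgue_measure measurable_unit) (@digits R).

Let pushforward_measure d d' (T : measurableType d) (T' : measurableType d')
    (mu : {measure set T -> \bar R}) (f : T -> T')
    (mf : measurable_fun [set: T] f) : {measure set T' -> \bar R} :=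
  measure_function_pushforward__canonical__measure_function_Measure mu mf.

Let coin_measure : {measure set borel_cantor -> \bar R} :=
  pushforward_measure (mrestr lebesgue_measure measurable_unit)
    (@measurable_digits R).

Let coin0 : coin set0 = 0%E.
Proof. exact: (measure0 coin_measure). Qed.

Let coin_ge0 A : (0 <= coin A)%E.
Proof. exact: (measure_ge0 coin_measure). Qed.

Let coin_sigma_additive : semi_sigma_additive coin.
Proof. exact: (@measure_semi_sigma_additive _ _ _ coin_measure). Qed.

HB.instance Definition _ := isMeasure.Build _ _ _ coin
  coin0 coin_ge0 coin_sigma_additive.

Let coinE A : coin A = lebesgue_measure (@digits R @^-1` A `&` `[0, 1[).
Proof. by []. Qed.

Let coin_cylinder s : coin (cylinder s) = (2^-1 ^+ size s)%:E.
Proof.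
pose k := cylinder_index s; have c0 : 0 < 2 ^+ size s :> R by rewrite exprn_gt0.
rewrite coinE (_ : _ `&` _ =
  `[k%:R / 2 ^+ size s, k.+1%:R / 2 ^+ size s[%classic); last first.
  apply/seteqP; split=> [x [/= xs x01]|x /=].
    move/digits_cylinder : (x01) => /(_ s)[/(_ xs) + _].
    move: x01; rewrite !in_itv/= => /andP[x0 _] /eqP.
    rewrite truncn_eq ?mulr_ge0// ?(ltW c0)// => /andP[kx xk].
    by rewrite ler_pdivrMr// ltr_pdivlMr// mulrC kx.
  rewrite in_itv/= ler_pdivrMr// ltr_pdivlMr// mulrC => /andP[kx xk].
  have x0 : 0 <= x by rewrite -(pmulr_rge0 _ c0) (le_trans _ kx).
  have x01 : x \in `[0, 1[.
    rewrite in_itv/= x0/= -(ltr_pM2l c0) mulr1 (lt_le_trans xk)//.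
    by rewrite -natrX ler_nat cylinder_index_lt.
  split=> //; apply/digits_cylinder => //.
  by apply/eqP; rewrite truncn_eq ?mulr_ge0// ?(ltW c0)// kx.
rewrite lebesgue_measure_itv/= lte_fin ltr_pM2r ?invr_gt0// ltr_nat ltnSn.
by rewrite -EFinD -mulrBl -natrB// subSnn mul1r exprVn.
Qed.

Let coin_setT : coin setT = 1%E.
Proof.
rewrite (_ : setT = cylinder [::]) ?coin_cylinder//.
by apply/seteqP; split.
Qed.

HB.instance Definition _ := @Measure_isProbability.Build _ _ R coin coin_setT.

Let shift x : borel_cantor -> borel_cantor := fun y => (x : cantor_space) + y.

Let shift_cylinder x s : shift x @^-1` cylinder s =
  cylinder (mkseq (fun i => x i (+) nth false s i) (size s)).
Proof.
apply/seteqP; split=> y /= h i; rewrite ?size_mkseq => si.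
  by rewrite nth_mkseq// -h// addbA addbb.
by have := h i; rewrite size_mkseq nth_mkseq// => /(_ si) yi;
  rewrite /shift/= /GRing.add/= /cantor_add yi addbA addbb.
Qed.

Let measurable_shift x : measurable_fun [set: borel_cantor] (shift x).
Proof.
apply: (measurability _ (@borel_cylinders R)) => _ [_ [->|[s _ <-]] <-].
  by rewrite preimage_set0 setI0.
rewrite setTI shift_cylinder; apply: sub_gen_smallest.
exact: (@open_cylinder R).
Qed.

Lemma haar_exists : exists mu : probability borel_cantor R, is_haar mu.
Proof.
exists coin => x A mA.
have -> : set_add [set x] A = shift x @^-1` A.
  apply/seteqP; split=> [_ [_ -> [y Ay <-]]|y /= xA].
    rewrite /= /shift (_ : x + (x + y) = y)//.
    by apply/funext => n; rewrite /GRing.add/= /cantor_add addbA addbb.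
  exists x => //; exists (x + y) => //.
  by apply/funext => n; rewrite /GRing.add/= /cantor_add addbA addbb.
rewrite -[LHS]/(pushforward_measure coin (measurable_shift x) A).
apply: (@measure_unique _ R borel_cantor cylinders (fun=> setT)) => //.
- exact: (@borel_cylinders R).
- exact: cylindersI.
- by move=> _; right; exists [::] => //; apply/seteqP; split.
- by rewrite bigcup_const.
- move=> _ [->|[s _ <-]]; first by rewrite !measure0.
  rewrite -[LHS]/(coin (shift x @^-1` cylinder s)).
  by rewrite shift_cylinder !coin_cylinder size_mkseq.
- by move=> _; rewrite -[ltLHS]/(coin setT) coin_setT ltry.
Qed.

(* Translation invariance determines a probability uniquely, so this is the
   Haar measure. *)
Definition haar : probability borel_cantor R := projT1 (cid haar_exists).

Lemma haarP : is_haar haar.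
Proof. exact: projT2 (cid haar_exists). Qed.

End haar.

Section topological_notions.
Context {T : topologicalType}.
Implicit Types (A : set T) (I : set (set T)).

Definition sigma_compact A : Prop :=
  exists2 F : (set T)^nat, (forall n, compact (F n)) & A = \bigcup_n F n.

Definition nowhere_dense A : Prop := (closure A)° = set0.

Definition meager : set (set T) :=
  [set A | exists2 F : (set T)^nat,
     (forall n, nowhere_dense (F n)) & A = \bigcup_n F n].

Definition sigma_ideal I : Prop :=
  [/\ I set0,
      (forall A B, A `<=` B -> I B -> I A) &
      (forall F : (set T)^nat, (forall n, I (F n)) -> I (\bigcup_n F n))].

End topological_notions.

(* The ideal generated by the closed null sets. The real field R only serves
   as the codomain of the measure. *)
Definition null_closed_ideal (R : realType) : set (set cantor_space) :=
  smallest sigma_ideal [set F | closed F /\ @haar R F = 0%E].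

Section additive_sets.
Implicit Types (J : set (set cantor_space)) (X : set cantor_space).

Definition additive_for J X : Prop := forall A, J A -> J (set_add X A).

Definition sharply_additive_for J X : Prop :=
  forall A, J A ->
    exists F, [/\ sigma_compact F, X `<=` F & J (set_add F A)].

Definition sharply_null X : Prop :=
  forall M, meager M ->
    exists F, [/\ sigma_compact F, X `<=` F & set_add F M <> setT].

End additive_sets.

Section hausdorff_dimension.
Context {R : realType} {T : metricType R}.
Implicit Types A : set T.
Local Open Scope ereal_scope.

(* 0 is added to the distances so that the empty set has diameter 0 *)
Definition diam A : \bar R :=
  ereal_sup (0 |` [set (mdist x y)%:E | x in A & y in A]).

Definition hausdorff_premeasure (delta s : R) A : \bar R :=
  ereal_inf [set \sum_(n <oo) diam (E n) `^ s | E in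
    [set E : (set T)^nat | A `<=` \bigcup_n E n /\
                           forall n, diam (E n) <= delta%:E]].

Definition hausdorff_measure (s : R) A : \bar R :=
  ereal_sup [set hausdorff_premeasure delta s A | delta in
    [set delta | (0 < delta)%R]].

(* Restricting to s > 0 does not change the infimum and avoids the convention
   needed for 0 `^ 0. *)
Definition hausdorff_dim A : \bar R :=
  ereal_inf [set s%:E | s in
    [set s : R | (0 < s)%R /\ hausdorff_measure s A = 0]].

End hausdorff_dimension.

Section upper_hausdorff_dimension.
Context {R : realType}.

(* The library's completeType is pointed, whereas a completion may be empty. *)
Definition complete_metric (Z : metricType R) : Prop :=
  forall F : set_system Z, ProperFilter F -> cauchy F ->
    exists l : Z, F --> l.

(* C, as a subspace of Z, is a completion of the subspace S of Y, the embedding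
   of S being the restriction of i. *)
Definition is_completion (Y : metricType R) (S : set Y)
    (Z : metricType R) (i : Y -> Z) (C : set Z) : Prop :=
  [/\ complete_metric Z,
      (forall x y, S x -> S y -> mdist (i x) (i y) = mdist x y) &
      C = closure (i @` S)].

(* Completions are unique up to isometry, so letting the completion vary does
   not change the infimum. *)
Definition upper_hausdorff_dim (Y : metricType R) (S : set Y) : \bar R :=
  ereal_inf [set d | exists (Z : metricType R) (i : Y -> Z) (C K : set Z),
    [/\ is_completion S i C, sigma_compact K, i @` S `<=` K, K `<=` C &
        d = hausdorff_dim K]].

Definition unif_continuous_on (Y Z : metricType R) (X : set Y) (f : Y -> Z) :=
  forall e : R, 0 < e -> exists2 d : R, 0 < d &
    forall x y, X x -> X y -> mdist x y < d -> mdist (f x) (f y) < e.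

(* A map defined on X is represented by a total one of which only the values
   on X matter. *)
Definition upper_hausdorff_null (T : metricType R) (X : set T) : Prop :=
  forall (Y : metricType R) (f : T -> Y), unif_continuous_on X f ->
    upper_hausdorff_dim (f @` X) = 0%E.

End upper_hausdorff_dimension.

(* Main.v *)
(* All six properties are equivalent to a combinatorial one: for every sequence
   h of lengths there are cylinders C_k of length h k and a partition of the
   indices k into consecutive finite groups such that every point of X belongs,
   for almost every group, to one of the cylinders of the group.

   A set so covered lies in the sigma-compact set F of all points with this
   property for the same cylinders. A meager set is contained in the set of the
   v that differ from some fixed z on almost every block [f k, f (k+1)[, and a
   set of E in the lower limit of clopen sets of measure 2^-k; adding F merges
   the blocks, or the clopen sets, of each group, and the result is again meager
   or in E. Under a uniformly continuous map with values in a metric space, the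
   images of small enough cylinders cover a sigma-compact set of dimension 0 in
   the completion.

   Conversely, let f be increasing and let M be the meager set of the v that
   vanish identically on only finitely many blocks [f k, f (k+1)[. If F + M
   misses y, every point of F agrees with y on infinitely many blocks, and
   compactness yields the groups. If X + M is contained in the set of the v that
   differ from z on almost every union of blocks, then each x in X agrees with z
   on some block of almost every union: otherwise copy z on the exceptional
   unions and the complement of x elsewhere. If X is null for the upper Hausdorff
   dimension, use the identity onto the Cantor set with a metric under which the
   cylinders of length h k have diameter about 1/k.

   For E-additive X, take for J the closed null set of the points whose
   restriction to every block lies in the support of a bent function. Distinct
   translates of such a support are pairwise independent, so by Chebyshev's
   inequality N of them cover all but a proportion 1/N of the words, whatever
   the length of the block. If X + J is in the lower limit of clopen sets D of
   very small measure, then at a word whose extensions rarely lie in D only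
   boundedly many restrictions of x to the next block can force all the
   extensions by x + J to lie in D more often; if x avoided these restrictions
   for infinitely many D, a point of x + J would escape infinitely many D. *)
Require Import Defs.
From HB Require Import structures.
From mathcomp Require Import all_boot all_order all_algebra.
From mathcomp Require Import all_classical all_reals all_analysis.
From mathcomp Require Import ring lra zify.

Set Implicit Arguments.
Unset Strict Implicit.
Unset Printing Implicit Defensive.

Import Order.TTheory GRing.Theory Num.Theory.
Import numFieldNormedType.Exports.

Local Open Scope classical_set_scope.
Local Open Scope ring_scope.

(** * Increasing sequences and the blocks they delimit *)

Definition incr (f : nat -> nat) := forall n, (f n < f n.+1)%N.

Lemma incr_ltn f m n : incr f -> (m < n)%N -> (f m < f n)%N.
Proof.
move=> fi; elim: n => // n ih; rewrite ltnS leq_eqVlt => /predU1P[->//|/ih].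
by move=> h; exact: ltn_trans h (fi n).
Qed.

Lemma incr_leq f m n : incr f -> (m <= n)%N -> (f m <= f n)%N.
Proof.
by move=> fi; rewrite leq_eqVlt => /predU1P[->//|/(incr_ltn fi)/ltnW].
Qed.

Lemma incr_ge f n : incr f -> (n <= f n)%N.
Proof. by move=> fi; elim: n => // n ih; exact: leq_ltn_trans ih (fi n). Qed.

Lemma incr_comp f g : incr f -> incr g -> incr (f \o g).
Proof. by move=> fi gi n; exact: incr_ltn fi (gi n). Qed.

Lemma incr_block_uniq f k k' i : incr f ->
  (f k <= i < f k.+1)%N -> (f k' <= i < f k'.+1)%N -> k = k'.
Proof.
move=> fi; wlog kk' : k k' / (k <= k')%N => [wl h1 h2|].
  have [/wl|/ltnW/wl] := leqP k k'; first exact.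
  by move/(_ h2 h1).
move=> /andP[_ h1] /andP[h2 _]; apply/eqP; rewrite eqn_leq kk' /= leqNgt.
apply/negP => /(incr_leq fi) h; lia.
Qed.

Lemma incr_block f i : incr f -> (f 0 <= i)%N ->
  exists k, (f k <= i < f k.+1)%N.
Proof.
move=> fi f0i; have : exists n, (i < f n.+1)%N.
  by exists i; exact: leq_trans (incr_ge _ fi).
move=> /ex_minnP[k ik kmin]; exists k; rewrite ik andbT.
case: k ik kmin => // k ik kmin; rewrite leqNgt; apply/negP => /kmin.
by rewrite ltnn.
Qed.

Lemma incr_majorant (h : nat -> nat) :
  exists2 f, incr f & forall n, (h n <= f n)%N.
Proof.
exists (fun n => \sum_(0 <= i < n.+1) (h i).+1)%N => n /=.
  by rewrite [ltnRHS]big_nat_recr//= addnS ltnS leq_addr.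
by rewrite big_nat_recr//= addnS ltnW// ltnS leq_addl.
Qed.

(** * Agreement on blocks of coordinates *)

Definition agree_on (a b : nat) (x y : cantor_space) :=
  forall i, (a <= i < b)%N -> x i = y i.

Lemma agree_sym n x y : agree n x y -> agree n y x.
Proof. by move=> h i /h. Qed.

Lemma agree_trans n y x z : agree n x y -> agree n y z -> agree n x z.
Proof. by move=> h1 h2 i ilt; rewrite h1// h2. Qed.

Lemma agree_le m n x y : (m <= n)%N -> agree n x y -> agree m x y.
Proof. by move=> mn h i im; apply: h; exact: leq_trans mn. Qed.

Lemma cantor_addE (x y : cantor_space) n : (x + y) n = x n (+) y n.
Proof. by []. Qed.

Lemma cantor_addxx (x : cantor_space) : x + x = 0.
Proof. by apply/funext => n; rewrite cantor_addE addbb. Qed.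

Lemma cantor_addKx (x y : cantor_space) : x + (x + y) = y.
Proof. by rewrite addrA cantor_addxx add0r. Qed.

Lemma agreeD n x y z t : agree n x y -> agree n z t -> agree n (x + z) (y + t).
Proof. by move=> h1 h2 i ilt; rewrite !cantor_addE h1// h2. Qed.

Lemma block_glue (f : nat -> nat) (w : nat -> cantor_space) : incr f ->
  exists y : cantor_space, forall k, agree_on (f k) (f k.+1) y (w k).
Proof.
move=> fi; have /choice[y yP] : forall i, exists b : bool,
    forall k, (f k <= i < f k.+1)%N -> b = w k i.
  move=> i; have [[k ki]|nk] := pselect (exists k, (f k <= i < f k.+1)%N).
    by exists (w k i) => k' /(incr_block_uniq fi ki) ->.
  by exists false => k ki; exfalso; apply: nk; exists k.
by exists y => k i ki; apply: yP.
Qed.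

Lemma agree_limit (f : nat -> nat) (e : nat -> cantor_space) : incr f ->
  (forall j, agree (f j) (e j) (e j.+1)) ->
  exists y, forall j, agree (f j) y (e j).
Proof.
move=> fi ee; have ee' j k : (j <= k)%N -> agree (f j) (e j) (e k).
  elim: k => [|k ih]; first by rewrite leqn0 => /eqP ->.
  rewrite leq_eqVlt => /predU1P[->//|jk].
  by apply: agree_trans (ih _) _ => //; apply: agree_le (ee k); exact: incr_leq.
(* Coordinate i is frozen from stage [i.+1] on, since [f i.+1] exceeds i. *)
exists (fun i => e i.+1 i) => j i ij.
have [ij'|ji] := leqP i.+1 j; last by rewrite (ee' _ _ (ltnW ji)).
by rewrite (ee' _ _ ij')//; exact: leq_trans (incr_ge _ fi).
Qed.

Section agree_topology.

Lemma nbhs_agree n (x : cantor_space) : nbhs x [set y | agree n x y].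
Proof.
apply/nbhsP; exists [set xy : cantor_space * cantor_space | agree n xy.1 xy.2].
  exact: entourage_agree.
by move=> y; rewrite /xsection/= inE.
Qed.

Lemma agree_nbhs (x : cantor_space) (A : set cantor_space) :
  nbhs x A -> exists n, [set y | agree n x y] `<=` A.
Proof.
move=> /nbhsP[E /agree_entourage[n nE] EA]; exists n => y xy.
by apply: EA; rewrite /xsection/= inE; apply: nE.
Qed.

Lemma nbhs_agreeP (x : cantor_space) (A : set cantor_space) :
  nbhs x A <-> exists n, [set y | agree n x y] `<=` A.
Proof.
split; first exact: agree_nbhs.
by move=> [n nA]; apply: filterS (nbhs_agree n x).
Qed.

Lemma open_agreeP (A : set cantor_space) :
  open A <-> forall x, A x -> exists n, [set y | agree n x y] `<=` A.
Proof.
rewrite openE; split=> h x Ax; first by apply/nbhs_agreeP; apply: h.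
by apply/nbhs_agreeP; exact: h.
Qed.

Lemma closed_agreeP (A : set cantor_space) :
  closed A <-> forall x, (forall n, exists2 y, A y & agree n x y) -> A x.
Proof.
split=> [cA x h|h x clx].
  apply: cA => B /agree_nbhs[n nB]; have [y Ay xy] := h n.
  by exists y; split => //; apply: nB.
apply: h => n; have [y [Ay xy]] := clx _ (nbhs_agree n x).
by exists y.
Qed.

End agree_topology.

Definition determined n (C : set cantor_space) :=
  forall x y, agree n x y -> C x -> C y.

Lemma determined_le m n C : (m <= n)%N -> determined m C -> determined n C.
Proof. by move=> mn h x y /(agree_le mn); exact: h. Qed.

Lemma determined_agree n x : determined n [set y | agree n x y].
Proof. by move=> y z yz xy; exact: agree_trans yz. Qed.

Lemma determined_open n C : determined n C -> open C.
Proof. by move=> dC; apply/open_agreeP => x Cx; exists n => y /dC; exact. Qed.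

Lemma determined_closed n C : determined n C -> closed C.
Proof.
move=> dC; apply/closed_agreeP => x /(_ n)[y Cy /agree_sym yx]; exact: dC Cy.
Qed.

Lemma determined_bigcup (m : nat -> nat) (C : nat -> set cantor_space) a b :
  (forall k, determined (m k) (C k)) ->
  exists n, determined n (\bigcup_(k in [set k | (a <= k < b)%N]) C k).
Proof.
move=> dC; have [f fi mf] := incr_majorant m.
exists (f b) => x y xy [k /= kab Ckx]; exists k => //=.
apply: dC Ckx; apply: agree_le xy; apply: leq_trans (mf k) _.
by apply: incr_leq => //; lia.
Qed.

(** * Meager sets *)

Definition eventually_differs (f : nat -> nat) (z : cantor_space) :=
  [set v | exists N, forall k, (N <= k)%N -> ~ agree_on (f k) (f k.+1) v z].

Lemma nowhere_dense_sub (A B : set cantor_space) :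
  A `<=` B -> nowhere_dense B -> nowhere_dense A.
Proof.
rewrite /nowhere_dense -!subset0 => AB B0; apply: subset_trans B0.
by apply: interiorS; exact: closureS.
Qed.

Lemma meager_sub (A B : set cantor_space) : A `<=` B -> meager B -> meager A.
Proof.
move=> AB [F Fn BF]; exists (fun n => F n `&` A).
  by move=> n; exact: nowhere_dense_sub (Fn n).
rewrite -setI_bigcupl -BF; apply/esym/setIidPr; exact: AB.
Qed.

Lemma nowhere_denseP (N : set cantor_space) : nowhere_dense N <->
  forall p c, exists b z, [/\ (c <= b)%N, agree c p z &
    forall v, N v -> ~ agree b z v].
Proof.
split=> [N0 p c|h].
  have [z pz nz] : exists2 z, agree c p z & ~ closure N z.
    apply: contrapT => h; have : (closure N)° p.
      apply: filterS (nbhs_agree c p) => z /= pz; apply: contrapT => nz.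
      by apply: h; exists z.
    by rewrite N0.
  have /agree_nbhs[b bN] : nbhs z (~` closure N).
    by apply: open_nbhs_nbhs; split => //; exact/closed_openC/closed_closure.
  exists (maxn b c), z; split; [lia|by []|move=> v Nv zv].
  apply: (bN v); last exact: subset_closure.
  by apply: agree_le zv; lia.
rewrite /nowhere_dense -subset0 => p /agree_nbhs[c cN].
have [b [z [cb pz nN]]] := h p c.
have [v [Nv zv]] := cN z pz _ (nbhs_agree b z).
exact: nN zv.
Qed.

Lemma meager_eventually_differs f z : incr f -> meager (eventually_differs f z).
Proof.
move=> fi.
exists (fun N =>
  [set v | forall k, (N <= k)%N -> ~ agree_on (f k) (f k.+1) v z]).
  move=> N; apply/nowhere_denseP => p c.
  (* The block of index k starts at or after c, so p can be followed up to c and z copied on the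
     whole block. *)
  pose k := maxn N c.
  exists (f k.+1), (fun i => if (i < c)%N then p i else z i); split.
  - by apply: leq_trans (incr_ge _ fi); rewrite /k; lia.
  - by move=> i /= ->.
  - move=> v /(_ k); rewrite /k leq_maxl => /(_ isT) h vz; apply: h => i ik.
    rewrite -vz; last by case/andP: ik.
    suff -> : (i < c)%N = false by [].
    by have := incr_ge k fi; rewrite /k; lia.
by apply/seteqP; split=> v; [move=> [N h]; exists N|move=> [N _ h]; exists N].
Qed.

(** The word found must avoid N whatever the first a coordinates are. Induction frees one more
    coordinate: extend with it set to false, then prolong the result with it set to true. A point
    matching the final word contradicts one of the two extensions, according to its own value
    there. *)
Lemma nowhere_dense_block (N : set cantor_space) : nowhere_dense N ->
  forall a (c : nat) (p : cantor_space), (a <= c)%N ->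
  exists b z, [/\ (c <= b)%N, agree_on a c p z &
    forall v, N v -> ~ agree_on a b v z].
Proof.
move=> /nowhere_denseP Nd; elim=> [|a ih] c p ac.
  have [b [z [cb pz nN]]] := Nd p c; exists b, z; split=> //.
  by move=> v Nv vz; apply: (nN v Nv) => i ib; rewrite vz.
pose set_at (b : bool) (x : cantor_space) : cantor_space :=
  fun i => if i == a then b else x i.
have set_atN b x i : (a < i)%N -> set_at b x i = x i.
  by rewrite /set_at; case: eqP => // ->; rewrite ltnn.
have [b [z [cb pz nz]]] := ih c (set_at false p) (ltnW ac).
have [b' [z' [bb' zz' nz']]] := ih b (set_at true z) (leq_trans (ltnW ac) cb).
exists b', z'; split; first lia.
  move=> i ic; rewrite -zz'; last lia.
  by rewrite set_atN -?pz ?set_atN//; lia.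
have z'a : z' a = true by rewrite -zz' ?/set_at ?eqxx//; lia.
have za : z a = false by rewrite -pz ?/set_at ?eqxx//; lia.
move=> v Nv vz'; case va : (v a).
  apply: (nz' v Nv) => i iab.
  by have [->|ia] := eqVneq i a; [rewrite va|apply: vz'; lia].
apply: (nz v Nv) => i iab.
have [->|ia] := eqVneq i a; first by rewrite va.
have ib : (a < i < b)%N by move: iab ia; lia.
rewrite vz'; last lia.
by rewrite -zz' ?set_atN//; lia.
Qed.

Lemma nowhere_dense_blocks (F : nat -> set cantor_space) :
  (forall n, nowhere_dense (F n)) -> forall n a,
  exists b z, (a < b)%N /\
    forall i v, (i < n)%N -> F i v -> ~ agree_on a b v z.
Proof.
move=> Fn; elim=> [|n ih] a; first by exists a.+1, 0; split.
have [b [z [ab bz]]] := ih a.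
have [c [z' [bc _ cz]]] := nowhere_dense_block (Fn n) 0 (leqnn b).
exists c, (fun i => if (i < b)%N then z i else z' i); split; first lia.
move=> i v; rewrite ltnS leq_eqVlt => /predU1P[-> Fv vz|ilt Fv vz].
  apply: (cz v Fv) => j jbc; rewrite vz; last lia.
  by rewrite ltnNge; case/andP: jbc => ->.
apply: (bz i v ilt Fv) => j jab; rewrite vz; last lia.
by case/andP: jab => _ ->.
Qed.

(** The n-th word avoids [F 0], ..., [F n], so a point of [F i] differs from z on every block from
    the i-th on. Lengthening a block is harmless, which allows its ends to be values of h: each
    block is then a union of the blocks of a prescribed partition. *)
Lemma meager_sub_eventually_differs M (h : nat -> nat) : meager M -> incr h ->
  exists g z, [/\ incr g, g 0 = 0%N & M `<=` eventually_differs (h \o g) z].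
Proof.
move=> [F Fn ->] hi.
have step n a : exists bz : nat * cantor_space, (a < bz.1)%N /\
    forall i v, (i <= n)%N -> F i v -> ~ agree_on (h a) (h bz.1) v bz.2.
  have [b [z [ab bz]]] := nowhere_dense_blocks Fn n.+1 (h a).
  exists (maxn a.+1 b, z); split=> /=; first lia.
  move=> i v ilt Fv vz; apply: (bz i v ilt Fv) => j /andP[aj jb].
  apply: vz; rewrite aj /=; apply: leq_trans jb _.
  by apply: leq_trans (incr_ge _ hi); lia.
have /choice[st stP] : forall na : nat * nat, exists bz : nat * cantor_space,
    (na.2 < bz.1)%N /\ forall i v, (i <= na.1)%N -> F i v ->
      ~ agree_on (h na.2) (h bz.1) v bz.2 by move=> [n a]; exact: step.
pose g := fix g n := if n is n'.+1 then (st (n', g n')).1 else 0%N.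
have gi : incr g by move=> n /=; have [] := stP (n, g n).
have [z zP] := block_glue (fun n => (st (n, g n)).2) (incr_comp hi gi).
exists g, z; split=> //.
move=> v [i _ Fiv]; exists i => n ilt vz.
have [_ /(_ i v ilt Fiv)] := stP (n, g n); apply => j ji.
by rewrite vz//; exact: (zP n).
Qed.

(** The combinatorial property through which all six are linked. Only the first [h k] coordinates of
    [w k] matter, and [g n] is the first index of the n-th group. *)
Definition groupably_covered (X : set cantor_space) (h : nat -> nat) :=
  exists (w : nat -> cantor_space) (g : nat -> nat), incr g /\
  forall x, X x -> exists N, forall n, (N <= n)%N ->
    exists2 k, (g n <= k < g n.+1)%N & agree (h k) (w k) x.

Lemma groupably_covered_incr X :
  (forall h, incr h -> groupably_covered X h) ->
  forall h, groupably_covered X h.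
Proof.
move=> Xh h; have [f fi hf] := incr_majorant h.
have [w [g [gi wP]]] := Xh f fi; exists w, g; split=> // x /wP[N NP].
exists N => n /NP[k kn wx]; exists k => //; exact: agree_le wx.
Qed.

Lemma eventually_differs_neqT f z : eventually_differs f z <> setT.
Proof.
move=> h; have : eventually_differs f z z by rewrite h.
by move=> [N /(_ N (leqnn _))]; apply.
Qed.

Lemma compact_incr_cover (T : topologicalType) (K : set T) (U : nat -> set T) :
  compact K -> (forall k, open (U k)) -> K `<=` \bigcup_k U k ->
  exists n, K `<=` \bigcup_(k in [set k | (k < n)%N]) U k.
Proof.
move=> /compact_near_coveringP cK oU KU.
have [x Kx|N _ /(_ N (leqnn N)) NP] := cK nat \oo
    (fun n x => exists2 k, (k < n)%N & U k x) _; last by exists N.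
have [k _ Ukx] := KU x Kx.
exists (U k, [set n | (k < n)%N]) => /=.
  by split; [exact: open_nbhs_nbhs|exists k.+1].
by move=> [y n] [/= Uy kn]; exists k.
Qed.

(** * Groupable covers from and to meager sets *)

Definition words n : seq (seq bool) := map val (enum {: n.-tuple bool}).

Lemma mem_words n s : (s \in words n) = (size s == n).
Proof.
apply/mapP/eqP => [[t _ ->]|<-]; first by rewrite size_tuple.
by exists (in_tuple s) => //; rewrite mem_enum.
Qed.

Lemma words_uniq n : uniq (words n).
Proof. by rewrite map_inj_uniq ?enum_uniq//; exact: val_inj. Qed.

Lemma size_words n : size (words n) = (2 ^ n)%N.
Proof. by rewrite size_map -cardE card_tuple card_bool. Qed.

Definition pref n (x : cantor_space) : seq bool := mkseq x n.
Definition ext (s : seq bool) : cantor_space := nth false s.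

Lemma size_pref n x : size (pref n x) = n. Proof. exact: size_mkseq. Qed.

Lemma pref_agree n x y : agree n x y -> pref n x = pref n y.
Proof.
by move=> xy; apply/eq_in_map => i; rewrite mem_iota => /andP[_ ilt]; exact: xy.
Qed.

Lemma agree_pref n x : agree n (ext (pref n x)) x.
Proof. by move=> i ilt; rewrite /ext nth_mkseq. Qed.

(** The list [l k] is stored at the places [s k], [s k + 1], ... reserved for it, and its i-th entry
    then has to match x on [h (s k + i)] coordinates. Places left over are filled with 0. *)
Lemma groupably_covered_lists X h (s g : nat -> nat)
    (l : nat -> seq cantor_space) :
  incr s -> incr g -> (forall k, (size (l k) <= s k.+1 - s k)%N) ->
  (forall x, X x -> exists N, forall n, (N <= n)%N ->
    exists k i, [/\ (g n <= k < g n.+1)%N, (i < size (l k))%N &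
      agree (h (s k + i)%N) (nth 0 (l k) i) x]) ->
  groupably_covered X h.
Proof.
move=> si gi sl Xl.
have /choice[w wP] : forall i, exists v, forall k, (s k <= i < s k.+1)%N ->
    v = nth 0 (l k) (i - s k).
  move=> i; have [[k ki]|nk] := pselect (exists k, (s k <= i < s k.+1)%N).
    by exists (nth 0 (l k) (i - s k)) => k' /(incr_block_uniq si ki) <-.
  by exists 0 => k ki; exfalso; apply: nk; exists k.
exists w, (s \o g); split; first exact: incr_comp.
move=> x /Xl[N NP]; exists N => n /NP[k [i [/andP[gk kg] il ag]]].
have ski : (s k <= s k + i < s k.+1)%N.
  by have := sl k; have := si k; lia.
exists (s k + i)%N.
  rewrite /=; have := incr_leq si gk; have := incr_leq si kg; lia.
by rewrite (wP _ k ski) addKn.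
Qed.

Definition block_matched (X : set cantor_space) (f : nat -> nat) :=
  exists (y : cantor_space) (g : nat -> nat), incr g /\
  forall x, X x -> exists N, forall n, (N <= n)%N ->
    exists2 k, (g n <= k < g n.+1)%N & agree_on (f k) (f k.+1) x y.

(** Agreement with y on a block says nothing of the coordinates before the block, so the k-th list
    consists of y with its first [f k] coordinates replaced by each of the [2 ^ f k] words. *)
Lemma groupably_covered_blocks X : (forall f, incr f -> block_matched X f) ->
  forall h, groupably_covered X h.
Proof.
move=> Xf; apply: groupably_covered_incr => h hi.
(* [s] reserves [2 ^ f k] places for the k-th list, and [f k.+1] exceeds h at all these places, so
   that the block reaches past the end of every cylinder of the list. *)
pose fs := fix fs k := if k is k'.+1 then
  ((h ((fs k').2 + 2 ^ (fs k').1) + (fs k').1).+1, (fs k').2 + 2 ^ (fs k').1)%N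
  else (0, 0)%N.
pose f k := (fs k).1; pose s k := (fs k).2.
have fS k : f k.+1 = (h (s k.+1) + f k).+1 by [].
have sS k : s k.+1 = (s k + 2 ^ f k)%N by [].
have fi : incr f by move=> k; rewrite fS; lia.
have si : incr s by move=> k; rewrite sS -[ltnLHS]addn0 ltn_add2l expn_gt0.
have [y [g [gi gP]]] := Xf f fi.
pose sp k (r : seq bool) : cantor_space :=
  fun i => if (i < f k)%N then nth false r i else y i.
apply: (@groupably_covered_lists X h s g
  (fun k => [seq sp k r | r <- words (f k)])) => //.
  by move=> k; rewrite size_map size_words sS addKn.
move=> x /gP[N NP]; exists N => n /NP[k kg xy].
have xw : pref (f k) x \in words (f k) by rewrite mem_words size_pref.
exists k, (index (pref (f k) x) (words (f k))); split=> //.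
  by rewrite size_map index_mem.
rewrite (nth_map [::]) ?index_mem// nth_index//.
move=> i ih; rewrite /sp; case: ltnP => [ifk|fki]; first by rewrite nth_mkseq.
rewrite xy// fki fS /= ltnS (leq_trans (ltnW ih))//.
rewrite (leq_trans _ (leq_addr _ _))//; apply: incr_leq => //.
by rewrite sS leq_add2l ltnW// -size_words index_mem.
Qed.

Lemma meager_additive_block_matched X :
  additive_for meager X -> forall f, incr f -> block_matched X f.
Proof.
move=> Xm f fi; have := Xm _ (meager_eventually_differs 0 fi).
move=> /meager_sub_eventually_differs/(_ fi)[g [z [gi g0 XM]]].
exists z, g; split => // x Xx; apply: contrapT => nN.
pose bad n := forall k, (g n <= k < g n.+1)%N -> ~ agree_on (f k) (f k.+1) x z.
have badN N : exists2 n, (N <= n)%N & bad n.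
  apply: contrapT => h; apply: nN; exists N => n Nn.
  apply: contrapT => h'; apply: h; exists n => // k kn xz.
  by apply: h'; exists k.
(* No block of f is zero in x + v: on a bad group v is z, which x never matches there, and elsewhere
   x + v is constantly true. Yet v copies z on infinitely many groups. *)
have [v vP] := block_glue (fun n => if `[< bad n >] then z else x + (fun=> true))
  (incr_comp fi gi).
have vM : set_add X (eventually_differs f 0) v.
  exists x => //; exists (x + v); last by rewrite cantor_addKx.
  exists 0%N => k _; have [n nk] : exists n, (g n <= k < g n.+1)%N.
    by apply: incr_block => //; rewrite g0.
  have sub i : (f k <= i < f k.+1)%N -> (f (g n) <= i < f (g n.+1))%N.
    move=> ik; have /andP[/(incr_leq fi) + /(incr_leq fi)] := nk; lia.
  case: asboolP (vP n) => [bn|_] vn xv.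
    apply: (bn k nk) => i ik; have := xv i ik; rewrite cantor_addE vn ?sub//.
    by rewrite -[RHS]/false; case: (x i); case: (z i).
  have fk : (f k <= f k < f k.+1)%N by rewrite leqnn fi.
  have := xv _ fk; rewrite cantor_addE vn ?sub// cantor_addE.
  by rewrite -[RHS]/false; case: (x _).
have [N NP] := XM _ vM; have [n Nn bn] := badN N.
by apply: (NP n Nn) => i ifg; rewrite (vP n)// asboolT.
Qed.

Lemma sharply_null_block_matched X :
  sharply_null X -> forall f, incr f -> block_matched X f.
Proof.
move=> Xn f fi; have [F [[K cK FK] XF FM]] :=
  Xn _ (meager_eventually_differs 0 fi).
have [y ny] : exists y, ~ set_add F (eventually_differs f 0) y.
  apply: contrapT => h; apply: FM; apply/seteqP; split=> // y _.
  by apply: contrapT => ny; apply: h; exists y.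
pose U k := [set x | agree_on (f k) (f k.+1) x y].
have Uo k : open (U k).
  apply: (@determined_open (f k.+1)) => x x' xx' Ux i ik.
  by rewrite -xx' ?Ux//; case/andP: ik.
(* Otherwise x + y would vanish on no block from N on, and y = x + (x + y) would lie in the sum that
   it misses. *)
have FU x N : F x -> exists2 k, (N <= k)%N & U k x.
  move=> Fx; apply: contrapT => h; apply: ny; exists x => //; exists (x + y).
    exists N => k Nk xy; apply: h; exists k => // i /xy.
    by rewrite cantor_addE -[RHS]/false; case: (x i); case: (y i).
  exact: cantor_addKx.
have /choice[b bP] : forall mN : nat * nat, exists b, forall x, K mN.1 x ->
    exists2 k, (mN.2 <= k < b)%N & U k x.
  move=> [m N]; have [|n nP] := @compact_incr_cover _ _
      (fun k => U (N + k)%N) (cK m) (fun k => Uo _).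
    move=> x Kx; have [|k Nk Ux] := FU x N; first by rewrite FK; exists m.
    by exists (k - N)%N => //; rewrite subnKC.
  exists (N + n)%N => x /nP[k /= kn Ux]; exists (N + k)%N => //.
  by rewrite leq_addr ltn_add2l.
(* The n-th group is long enough for [K 0], ..., [K n] at once, so the points of [K m] are matched
   from the m-th group on. *)
pose g := fix g n := if n is n'.+1 then
  maxn (g n').+1 (\max_(m < n'.+1) b (val m, g n'))%N else 0%N.
have gi : incr g by move=> n /=; exact: leq_maxl.
exists y, g; split => // x /XF; rewrite FK => -[m _ Kx].
exists m => n mn; have [k /andP[gk kb] Ux] := bP (m, g n) x Kx.
exists k => //; rewrite gk /= (leq_trans kb)// leq_max; apply/orP; right.
exact: (@leq_bigmax _ (fun i : 'I_n.+1 => b (val i, g n))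
  (Ordinal (mn : m < n.+1)%N)).
Qed.

(** For a fixed N the condition defines an intersection of finite unions of cylinders, closed and
    hence compact; F is the union over N. *)
Lemma groupably_covered_sigma_compact X h : groupably_covered X h ->
  exists w g F, [/\ incr g, sigma_compact F, X `<=` F &
    forall x, F x -> exists N, forall n, (N <= n)%N ->
      exists2 k, (g n <= k < g n.+1)%N & agree (h k) (w k) x].
Proof.
move=> [w [g [gi wP]]].
pose F := [set x | exists N, forall n, (N <= n)%N ->
  exists2 k, (g n <= k < g n.+1)%N & agree (h k) (w k) x].
exists w, g, F; split=> //.
exists (fun N => \bigcap_(n in [set n | (N <= n)%N])
  \bigcup_(k in [set k | (g n <= k < g n.+1)%N]) [set x | agree (h k) (w k) x]).
  move=> N; apply: (@subclosed_compact _ _ setT) => //; last first.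
    exact: cantor_space_compact.
  apply: closed_bigI => n _.
  have [|m] := @determined_bigcup h (fun k => [set x | agree (h k) (w k) x])
      (g n) (g n.+1); first by move=> k; exact: determined_agree.
  exact: determined_closed.
apply/seteqP; split=> x [N].
  by move=> NP; exists N => // n /NP[k kn ag]; exists k.
by move=> _ NP; exists N => n /NP[k kn ag]; exists k.
Qed.

Lemma groupably_covered_sharply_meager_additive X :
  (forall h, groupably_covered X h) -> sharply_additive_for meager X.
Proof.
move=> Xh M mM.
have [f [z [fi _ Mz]]] :=
  meager_sub_eventually_differs mM (fun n => leqnn n.+1 : id n < id n.+1)%N.
(* Length [f k.+1] makes the k-th cylinder prescribe the whole k-th block. *)
have [w [g [F [gi sF XF FP]]]] :=
  groupably_covered_sigma_compact (Xh (fun k => f k.+1)).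
have [y yP] := block_glue w fi.
exists F; split=> //.
(* If x matches [w k] and v differs from z on the k-th block, then x + v differs from y + z there,
   hence on the union of the blocks of its group. *)
apply: meager_sub (meager_eventually_differs (y + z) (incr_comp fi gi)).
move=> _ [x /FP[N NP] [v /Mz[N' NP'] <-]].
exists (maxn N N') => n; rewrite geq_max => /andP[/NP[k kn wx] N'n] xvyz.
have N'k : (N' <= k)%N by have := incr_ge n gi; lia.
apply: (NP' k N'k) => i /= ik.
have := xvyz i; rewrite !cantor_addE (yP k)// -wx; last by case/andP: ik.
have -> : (((f \o g) n <= i < (f \o g) n.+1) = true)%N.
  have /andP[/(incr_leq fi) + /(incr_leq fi)] := kn => /=; lia.
by move=> /(_ isT); case: (w k i); case: (v i); case: (z i).
Qed.

(** The whole space is not meager, because z itself never belongs to the set of points eventually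
    differing from z. *)
Lemma sharply_meager_additive_sharply_null X :
  sharply_additive_for meager X -> sharply_null X.
Proof.
move=> Xs M /Xs[F [sF XF mF]]; exists F; split=> // FM.
have [f [z [_ _]]] :=
  meager_sub_eventually_differs mF (fun n => leqnn n.+1 : id n < id n.+1)%N.
rewrite FM => Tz; apply: (@eventually_differs_neqT (id \o f) z).
by apply/seteqP; split.
Qed.

Lemma sharply_additive_for_additive (J : set (set cantor_space)) X :
  (forall A B, A `<=` B -> J B -> J A) ->
  sharply_additive_for J X -> additive_for J X.
Proof.
move=> Js Xs A /Xs[F [_ XF]]; apply: Js => _ [x Xx [y Ay <-]].
by exists x; [exact: XF|exists y].
Qed.

Lemma half_expn_lt (R : realType) (d : R) : 0 < d -> exists n, 2^-1 ^+ n < d.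
Proof.
move=> d0; have half1 : `|2^-1 : R| < 1 by rewrite ger0_norm ?invf_lt1// ltr1n.
have [n _ /(_ n (leqnn n))/=] := @cvgr0_norm_lt _ _ _ _ _ (GRing.exp (2^-1 : R))
  (cvg_expr half1) d d0.
by rewrite ger0_norm ?exprn_ge0// => ?; exists n.
Qed.

(** * Haar measure of clopen sets *)

Section avg.
Context {R : realType}.
Implicit Types F G : seq bool -> R.

(** The mean over the [2 ^ m] words of length m, by recursion on the first letter, so that a word
    can be split anywhere ([avg_cat]). *)
Fixpoint avg m F : R := if m is m'.+1 then
  (avg m' (fun s => F (false :: s)) + avg m' (fun s => F (true :: s))) / 2
  else F [::].

Lemma avg_cat m n F : avg (m + n) F = avg m (fun s => avg n (fun t => F (s ++ t))).
Proof. by elim: m F => // m ih F /=; rewrite !ih. Qed.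

Lemma le_avg m F G : (forall s, size s = m -> F s <= G s) -> avg m F <= avg m G.
Proof.
elim: m F G => [|m ih] F G FG /=; first exact: FG.
by rewrite ler_pM2r ?invr_gt0// lerD// ih// => s sm; apply: FG; rewrite /= sm.
Qed.

Lemma eq_avg m F G : (forall s, size s = m -> F s = G s) -> avg m F = avg m G.
Proof. by move=> FG; apply/eqP; rewrite eq_le !le_avg// => s /FG ->. Qed.

Lemma avgZ m c F : avg m (fun s => c * F s) = c * avg m F.
Proof. by elim: m F => // m ih F /=; rewrite !ih; lra. Qed.

Lemma avgD m F G : avg m (fun s => F s + G s) = avg m F + avg m G.
Proof. by elim: m F G => // m ih F G /=; rewrite !ih; lra. Qed.

Lemma avg_cst m c : avg m (fun=> c) = c.
Proof. by elim: m => // m ih /=; rewrite ih; lra. Qed.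

Lemma avg_sum m (I : Type) (r : seq I) (F : I -> seq bool -> R) :
  avg m (fun s => \sum_(i <- r) F i s) = \sum_(i <- r) avg m (F i).
Proof.
elim: r => [|i r ih].
  by under eq_avg do rewrite big_nil; rewrite avg_cst big_nil.
by under eq_avg do rewrite big_cons; rewrite avgD ih big_cons.
Qed.

Lemma avg_ge0 m F : (forall s, size s = m -> 0 <= F s) -> 0 <= avg m F.
Proof. by move=> F0; rewrite -(avg_cst m 0); exact: le_avg. Qed.

Lemma avg_ge_point m F r : (forall s, 0 <= F s) -> size r = m ->
  F r <= 2 ^+ m * avg m F.
Proof.
elim: m F r => [|m ih] F r F0; first by move=> /size0nil ->; rewrite mul1r.
case: r => //= b r [rm].
have /(_ m (fun s => F (false :: s))) h := avg_ge0.
have /(_ m (fun s => F (true :: s))) h' := avg_ge0.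
have := ih (fun s => F (b :: s)) r (fun s => F0 _) rm; rewrite exprS.
have p0 : 0 < 2 ^+ m :> R by rewrite exprn_gt0.
have {}h : 0 <= avg m (fun s => F (false :: s)) by apply: h => s _; exact: F0.
have {}h' : 0 <= avg m (fun s => F (true :: s)) by apply: h' => s _; exact: F0.
have := mulr_ge0 (ltW p0) h; have := mulr_ge0 (ltW p0) h'.
by case: b; lra.
Qed.

End avg.

Section haar_facts.
Context {R : realType}.
Local Notation mu := (@haar R).
Implicit Types C : set cantor_space.

Lemma measurable_open C : open C -> @measurable _ borel_cantor C.
Proof. exact: sub_gen_smallest. Qed.

Lemma measurable_closed C : closed C -> @measurable _ borel_cantor C.
Proof.
move=> cC; rewrite -(setCK C).
by apply: (@measurableC _ borel_cantor); apply: measurable_open; exact: closed_openC.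
Qed.

Lemma measurable_determined n C :
  determined n C -> @measurable _ borel_cantor C.
Proof. by move=> /determined_open; exact: measurable_open. Qed.

Lemma haar_le C D : @measurable _ borel_cantor C ->
  @measurable _ borel_cantor D -> C `<=` D -> (mu C <= mu D)%E.
Proof. by move=> mC mD CD; apply: le_measure => //; rewrite inE. Qed.

Lemma mem_set_add (x y : cantor_space) C : set_add [set x] C y <-> C (x + y).
Proof.
split=> [[_ -> [z Cz <-]]|Cxy]; first by rewrite cantor_addKx.
by exists x => //; exists (x + y); rewrite ?cantor_addKx.
Qed.

Lemma determined_cylinder s : determined (size s) (cylinder s).
Proof. by move=> x y xy xs i si; rewrite -xy// xs. Qed.

Lemma cylinder_rcons s b x :
  cylinder (rcons s b) x <-> cylinder s x /\ x (size s) = b.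
Proof.
rewrite /cylinder/= size_rcons; split=> [h|[h hb] i].
  split=> [i si|]; last by rewrite h// nth_rcons ltnn eqxx.
  by rewrite h ?ltnS 1?ltnW// nth_rcons si.
rewrite ltnS leq_eqVlt nth_rcons => /predU1P[->|si]; first by rewrite ltnn eqxx.
by rewrite si h.
Qed.

Lemma haar_cylinderU C n s : determined n C ->
  mu (C `&` cylinder s) =
  (mu (C `&` cylinder (rcons s false)) + mu (C `&` cylinder (rcons s true)))%E.
Proof.
move=> dC; rewrite -measureU.
- congr (mu _); apply/seteqP; split=> x.
    move=> [Cx xs]; case xb : (x (size s)); [right|left]; split=> //;
    exact/cylinder_rcons.
  by move=> [|] [Cx /cylinder_rcons[xs _]].
- apply: (@measurableI _ borel_cantor); apply: measurable_determined;
    [exact: dC|exact: determined_cylinder].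
- apply: (@measurableI _ borel_cantor); apply: measurable_determined;
    [exact: dC|exact: determined_cylinder].
- rewrite -subset0 => x [[_ /cylinder_rcons[_ xf]] [_ /cylinder_rcons[_]]].
  by rewrite xf.
Qed.

(** Adding the sequence whose only nonzero coordinate is [size s] exchanges the two halves of the
    cylinder, which by invariance have equal measure. *)
Lemma haar_cylinder s : mu (cylinder s) = (2^-1 ^+ size s)%:E.
Proof.
elim/last_ind: s => [|s b ih].
  rewrite (_ : cylinder [::] = setT) ?probability_setT//.
  by apply/seteqP; split.
have tf : mu (cylinder (rcons s true)) = mu (cylinder (rcons s false)).
  pose e : cantor_space := fun i => i == size s.
  rewrite -(@haarP R e (cylinder (rcons s false))); last first.
    exact: measurable_determined (@determined_cylinder _).
  congr (mu _); apply/seteqP; split=> x.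
    move=> /cylinder_rcons[xs xt]; apply/mem_set_add/cylinder_rcons.
    split=> [i si|]; last by rewrite cantor_addE xt /e eqxx.
    by rewrite cantor_addE /e (ltn_eqF si) xs.
  move=> /mem_set_add/cylinder_rcons[xs xt]; apply/cylinder_rcons.
  split=> [i si|]; last by move: xt; rewrite cantor_addE /e eqxx; case: (x _).
  by rewrite -(xs i si) cantor_addE /e (ltn_eqF si).
have dT : determined 0 [set: cantor_space] by [].
have := haar_cylinderU s dT; rewrite !setTI ih tf => h.
have -> : mu (cylinder (rcons s b)) = mu (cylinder (rcons s false)).
  by case: b.
have mfin : mu (cylinder (rcons s false)) \is a fin_num.
  by apply: fin_num_measure; exact: measurable_determined (@determined_cylinder _).
move: h; rewrite -(fineK mfin) -EFinD => -[h]; congr EFin.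
by rewrite size_rcons exprS h; lra.
Qed.

Lemma haar_determined_cylinder m C s : determined (size s + m) C ->
  mu (C `&` cylinder s) =
  (2^-1 ^+ size s * avg m (fun t => \1_C (ext (s ++ t))))%:E.
Proof.
elim: m s => [|m ih] s dC /=.
  rewrite cats0 indicE; have exts : cylinder s (ext s) by [].
  have xe x : cylinder s x -> agree (size s + 0) (ext s) x.
    by move=> xs i; rewrite addn0 => si; rewrite xs.
  case: (boolP (_ \in _)); rewrite ?inE => Cs.
    rewrite mulr1 (_ : C `&` cylinder s = cylinder s) ?haar_cylinder//.
    by apply/setIidPr => x xs; exact: dC (xe x xs) Cs.
  rewrite mulr0 (_ : C `&` cylinder s = set0) ?measure0// -subset0 => x [Cx xs].
  by move: Cs; rewrite notin_setE; apply; exact: dC (agree_sym (xe x xs)) Cx.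
rewrite (haar_cylinderU _ dC) !ih ?size_rcons ?addSnnS// -EFinD; congr EFin.
have e b : avg m (fun t => \1_C (ext (rcons s b ++ t)) : R) =
    avg m (fun t => \1_C (ext (s ++ b :: t))).
  by apply: eq_avg => t _; rewrite cat_rcons.
by rewrite !e exprS; lra.
Qed.

Lemma haar_determined n C : determined n C ->
  mu C = (avg n (fun s => \1_C (ext s)))%:E.
Proof.
move=> dC; have := @haar_determined_cylinder n C [::] dC.
rewrite mul1r (_ : cylinder [::] = setT) ?setIT//.
by apply/seteqP; split.
Qed.

Lemma haar_bigcup (m : nat -> nat) (C : nat -> set cantor_space) a b :
  (forall k, determined (m k) (C k)) ->
  (forall k, (mu (C k) <= (2^-1 ^+ k)%:E)%E) ->
  (mu (\bigcup_(k in [set k | (a <= k < b)%N]) C k) <=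
    (2 * 2^-1 ^+ a)%:E)%E.
Proof.
move=> dC muC; have [ab|ba] := leqP a b; last first.
  rewrite (_ : \bigcup_(_ in _) _ = set0) ?measure0.
    by rewrite lee_fin mulr_ge0// exprn_ge0.
  by rewrite -subset0 => x [k /= kab]; lia.
(* The exact geometric sum is what passes through the induction on b - a. *)
apply: (@le_trans _ _ (2 * 2^-1 ^+ a - 2 * 2^-1 ^+ b)%:E); last first.
  by rewrite lee_fin gerBl mulr_ge0// exprn_ge0.
rewrite -(subnKC ab); elim: (b - a)%N => [|n ih].
  rewrite addn0 subrr (_ : \bigcup_(_ in _) _ = set0) ?measure0//.
  by rewrite -subset0 => x [k /= kab]; lia.
have [q dq] := determined_bigcup a (a + n)%N dC.
rewrite (_ : \bigcup_(_ in _) _ =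
    \bigcup_(k in [set k | (a <= k < a + n)%N]) C k `|` C (a + n)%N).
  apply: le_trans (measureU2 _ _ _) _.
  - exact: measurable_determined dq.
  - exact: measurable_determined (dC _).
  apply: le_trans (leeD ih (muC _)) _.
  rewrite -EFinD lee_fin addnS exprS; lra.
apply/seteqP; split=> x.
  move=> [k /= /andP[ak]]; rewrite addnS ltnS leq_eqVlt => /predU1P[->|kn] Ckx.
    by right.
  by left; exists k => //=; rewrite ak.
move=> [[k /= kan Ckx]|Cx]; first by exists k => //=; lia.
by exists (a + n)%N => //=; lia.
Qed.

Lemma haar_shift C x : @measurable _ borel_cantor C ->
  mu (set_add [set x] C) = mu C.
Proof. exact: haarP. Qed.

Lemma determined_shift n C x :
  determined n C -> determined n (set_add [set x] C).
Proof.
move=> dC y z yz /mem_set_add Cy; apply/mem_set_add.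
by apply: dC Cy => i ilt; rewrite !cantor_addE yz.
Qed.

(** The sets [U n] of the points agreeing with a point of F up to n decrease to F because F is
    closed; continuity from above makes their measures tend to 0. *)
Lemma closed_null_clopen F : closed F -> mu F = 0%E -> forall k,
  exists n C, [/\ determined n C, (mu C <= (2^-1 ^+ k)%:E)%E & F `<=` C].
Proof.
move=> cF F0 k; pose U n := [set x | exists2 v, F v & agree n v x].
have dU n : determined n (U n).
  by move=> x y xy [v Fv vx]; exists v => //; exact: agree_trans xy.
have UF : \bigcap_n U n = F.
  apply/seteqP; split=> x; last by move=> Fx n _; exists x.
  move=> Ux; move/closed_agreeP : cF; apply => n.
  by have [v Fv /agree_sym vx] := Ux n I; exists v.
have : mu \o U @ \oo --> mu (\bigcap_n U n).
  apply: nonincreasing_cvg_mu.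
  - apply: (@le_lt_trans _ _ 1%E); last exact: ltry.
    by apply: probability_le1; exact: measurable_determined (dU 0%N).
  - by move=> n; exact: measurable_determined (dU n).
  - by rewrite UF; exact: measurable_closed.
  - move=> m n mn; apply/subsetPset => x [v Fv vx]; exists v => //.
    exact: agree_le vx.
rewrite UF F0 => /fine_cvgP[_ /cvgrPdist_lt/(_ (2^-1 ^+ k))].
case=> [|n _ /(_ n (leqnn n))/=]; first by rewrite exprn_gt0.
rewrite sub0r normrN ger0_norm ?fine_ge0// => Un.
exists n, (U n); split => //; last by move=> x Fx; exists x.
rewrite -(@fineK _ (mu (U n))) ?lee_fin ?ltW//.
by apply: fin_num_measure; exact: measurable_determined (dU n).
Qed.

(** The form in which membership in the ideal is exploited. It passes to the whole ideal because
    such sets form a sigma-ideal containing the closed null sets. *)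
Definition clopen_small (A : set cantor_space) :=
  exists (n : nat -> nat) (C : nat -> set cantor_space),
  [/\ forall k, determined (n k) (C k),
      forall k, (mu (C k) <= (2^-1 ^+ k)%:E)%E &
      forall x, A x -> exists N, forall k, (N <= k)%N -> C k x].

Lemma clopen_small_sigma_ideal : sigma_ideal clopen_small.
Proof.
split.
- exists (fun=> 0%N), (fun=> set0); split=> // k; first by move=> x y _.
  by rewrite measure0 lee_fin exprn_ge0.
- move=> A B AB [n [C [dC muC BC]]]; exists n, C; split=> // x /AB; exact: BC.
- move=> F /choice[n /choice[C FC]].
  (* [D k] merges the clopen sets of index [k.+1 + i] of [F i] for i up to k; the index j =
     [k.+1 + i] makes the measures a geometric sum of at most [2^-1 ^+ k]. *)
  pose D k := \bigcup_(j in [set j | (k.+1 <= j < k.*2.+2)%N]) C (j - k.+1)%N j.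
  have dD k : exists m, determined m (D k).
    apply: (@determined_bigcup (fun j => n (j - k.+1)%N j)) => j.
    by have [] := FC (j - k.+1)%N.
  have /choice[m mD] := dD.
  exists m, D; split=> //.
    move=> k; apply: le_trans (@haar_bigcup (fun j => n (j - k.+1)%N j) _ _ _ _ _) _.
    + by move=> j; have [] := FC (j - k.+1)%N.
    + by move=> j; have [] := FC (j - k.+1)%N.
    + by rewrite lee_fin exprS mulrA mulfV// mul1r.
  move=> x [i _ Fix]; have [_ _ /(_ x Fix)[N NP]] := FC i.
  exists (maxn i N) => k; rewrite geq_max => /andP[ik Nk].
  exists (k.+1 + i)%N => /=; first by lia.
  by rewrite addKn; apply: NP; lia.
Qed.

Lemma null_closed_ideal_clopen_small A : null_closed_ideal R A -> clopen_small A.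
Proof.
apply; split; first exact: clopen_small_sigma_ideal.
move=> F [cF F0]; have /choice[n /choice[C FC]] := closed_null_clopen cF F0.
exists n, C; split=> [k|k|x Fx]; try by have [] := FC k.
by exists 0%N => k _; have [_ _] := FC k; apply.
Qed.

Lemma null_closed_ideal_sigma_ideal : sigma_ideal (null_closed_ideal R).
Proof.
split.
- by move=> I [[I0 _ _] _].
- by move=> A B AB IB I hI; have [[_ IS _] _] := hI; exact: IS AB (IB I hI).
- move=> F IF I hI; have [[_ _ IU] _] := hI; apply: IU => n; exact: IF n I hI.
Qed.

Lemma haar_eq0 C : (forall n, (mu C <= (2 * 2^-1 ^+ n)%:E)%E) -> mu C = 0%E.
Proof.
move=> Cn; apply/eqP; rewrite eq_le measure_ge0 andbT.
apply/lee_addgt0Pr => e e0; rewrite add0e.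
have [n] : exists n, 2^-1 ^+ n < e / 2 by apply: half_expn_lt; rewrite divr_gt0.
rewrite ltr_pdivlMr// mulrC => ne.
by apply: le_trans (Cn n) _; rewrite lee_fin ltW.
Qed.

Lemma groupably_covered_sharply_null_closed_additive X :
  (forall h, groupably_covered X h) ->
  sharply_additive_for (null_closed_ideal R) X.
Proof.
move=> Xh A /null_closed_ideal_clopen_small[m [C [dC muC AC]]].
have [w [g [F [gi sF XF FP]]]] := groupably_covered_sigma_compact (Xh m).
exists F; split=> //.
(* As [C k] depends on the first [m k] coordinates only, x + v lies in [D k] once x matches [w k]
   there and v is in [C k]. *)
pose D k := set_add [set w k] (C k).
have dD k : determined (m k) (D k) by exact: determined_shift.
have muD k : (mu (D k) <= (2^-1 ^+ k)%:E)%E.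
  by rewrite haar_shift//; exact: measurable_determined (dC k).
pose B n := \bigcup_(k in [set k | (g n <= k < g n.+1)%N]) D k.
have /choice[q dB] : forall n, exists q, determined q (B n).
  by move=> n; exact: (determined_bigcup _ _ dD).
have [_ Isub Icup] := null_closed_ideal_sigma_ideal.
apply: (Isub _ (\bigcup_N \bigcap_(n in [set n | (N <= n)%N]) B n)).
  move=> _ [x /FP[N NP] [v /AC[N' NP'] <-]].
  exists (maxn N N') => // n /=; rewrite geq_max => /andP[/NP[k kn wx] N'n].
  exists k => //; apply/mem_set_add; apply: dC (NP' k _); last first.
    by have := incr_ge n gi; move: kn; lia.
  move=> i ik; rewrite !cantor_addE wx//; by case: (x i); case: (v i).
apply: Icup => N; have cB : closed (\bigcap_(n in [set n | (N <= n)%N]) B n).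
  by apply: closed_bigI => n _; exact: determined_closed (dB n).
move=> I [_]; apply; split=> //; apply: haar_eq0 => n; pose p := maxn n N.
apply: (@le_trans _ _ (mu (B p))).
  apply: haar_le; [exact: measurable_closed|exact: measurable_determined (dB p)|].
  by apply: bigcap_inf; rewrite /= /p leq_maxr.
apply: le_trans (haar_bigcup _ _ dD muD) _.
rewrite lee_fin ler_pM2l// ler_wiXn2l ?invf_le1 ?ler1n//.
by have := incr_ge p gi; rewrite /p; lia.
Qed.

End haar_facts.

(** * Bent functions *)

(** The quadratic form x0 x1 + x2 x3 + ... over the field with two elements, the standard bent
    function. *)
Fixpoint bent (s : seq bool) : bool :=
  if s is a :: b :: s' then (a && b) (+) bent s' else false.

Definition xorw (s t : seq bool) := [seq p.1 (+) p.2 | p <- zip s t].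

Lemma size_xorw s t : size s = size t -> size (xorw s t) = size t.
Proof. by move=> st; rewrite size_map size2_zip// st. Qed.

Lemma xorw_cons a b s t : xorw (a :: s) (b :: t) = (a (+) b) :: xorw s t.
Proof. by []. Qed.

Lemma xorwK s t : size s = size t -> xorw t (xorw s t) = s.
Proof.
elim: s t => [|a s ih] [|b t]// [st].
by rewrite !xorw_cons ih//; case: a; case: b.
Qed.

Lemma xorwKr s t : size s = size t -> xorw (xorw s t) t = s.
Proof.
elim: s t => [|a s ih] [|b t]// [st].
by rewrite !xorw_cons ih// -addbA addbb addbF.
Qed.

Lemma bent_true m : bent (true :: true :: nseq m false).
Proof.
suff h k : bent (nseq k false) = false by rewrite /= h.
by elim/ltn_ind: k => -[|[|k]] //= ih; rewrite ih.
Qed.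

Section bent.
Context {R : realType}.

Definition chi (s : seq bool) : R := (-1) ^+ bent s.

Lemma chi_cons a b s : chi [:: a, b & s] = (-1) ^+ (a && b) * chi s.
Proof. by rewrite /chi/= signr_addb. Qed.

(** Each pair of letters contributes three signs +1 and one sign -1, a factor 1/2. *)
Lemma avg_bent_ge0 m : 0 <= avg m.*2 chi.
Proof.
elim: m => [|m ih]; first by rewrite /= /chi/= expr0.
rewrite doubleS [avg _ _]/=.
have e a b : avg m.*2 (fun s => chi [:: a, b & s]) =
    (-1) ^+ (a && b) * avg m.*2 chi.
  by rewrite -avgZ; apply: eq_avg => s _; rewrite chi_cons.
by rewrite !e /= expr1 !expr0; lra.
Qed.

Lemma avg_bent_le m : avg m.*2 (fun s => (bent s)%:R : R) <= 2^-1.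
Proof.
have -> : avg m.*2 (fun s => (bent s)%:R : R) =
    avg m.*2 (fun s => 2^-1 + (- 2^-1) * chi s).
  apply: eq_avg => s _; rewrite /chi.
  by case: (bent s); rewrite /= ?expr1 ?expr0; lra.
by rewrite avgD avg_cst avgZ; have := avg_bent_ge0 m; lra.
Qed.

(** Orthogonality of translates, characteristic of bent functions. The mean factors over pairs of
    letters, and a pair contributes 0 unless t and t' coincide on it. *)
Lemma avg_chi_chi m t t' : size t = m.*2 -> size t' = m.*2 ->
  avg m.*2 (fun s => chi (xorw s t) * chi (xorw s t')) = (t == t')%:R.
Proof.
elim: m t t' => [|m ih] t t'.
  by move=> /size0nil -> /size0nil -> /=; rewrite /chi/= expr0 mulr1.
rewrite doubleS; case: t => [|a [|b t]]// [st]; case: t' => [|a' [|b' t']]// [st'].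
have e c d : avg m.*2 (fun s => chi (xorw [:: c, d & s] [:: a, b & t]) *
      chi (xorw [:: c, d & s] [:: a', b' & t'])) =
    (-1) ^+ ((c (+) a) && (d (+) b)) * (-1) ^+ ((c (+) a') && (d (+) b')) *
      (t == t')%:R.
  rewrite -(ih _ _ st st') -avgZ; apply: eq_avg => s _.
  by rewrite !xorw_cons !chi_cons mulrACA.
rewrite [avg _ _]/= !e !eqseq_cons; case: (t == t'); rewrite ?andbF ?andbT;
by case: a b a' b' {e} => [] [] [] []; rewrite /= ?expr1 ?expr0; lra.
Qed.

(* Chebyshev: off V the size ts translates of chi all equal 1, whereas the second
   moment of their sum is only size ts, as they are orthogonal. *)
Lemma bent_translates_avg m (ts : seq (seq bool)) (V : pred (seq bool)) :
  uniq ts -> (forall t, t \in ts -> size t = m.*2) ->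
  (forall t v, t \in ts -> size v = m.*2 -> bent (xorw v t) -> V v) ->
  (size ts)%:R * avg m.*2 (fun v => (~~ V v)%:R : R) <= 1.
Proof.
move=> ut st tV; pose S v := \sum_(t <- ts) chi (xorw v t).
have S2 : avg m.*2 (fun v => S v ^+ 2) = (size ts)%:R.
  transitivity (avg m.*2 (fun v => \sum_(t <- ts) \sum_(t' <- ts)
      (chi (xorw v t) * chi (xorw v t')))).
    apply: eq_avg => v _; rewrite expr2 {1}/S mulr_suml; apply: eq_bigr => t _.
    by rewrite mulr_sumr.
  rewrite avg_sum -sum1_size natr_sum big_seq [RHS]big_seq; apply: eq_bigr => t tts.
  rewrite avg_sum (bigD1_seq t)//= avg_chi_chi ?st// eqxx big_seq_cond big1 ?addr0//.
  by move=> t' /andP[t'ts t't]; rewrite avg_chi_chi ?st// eq_sym (negbTE t't).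
have := @le_avg R m.*2 (fun v => (size ts)%:R ^+ 2 * (~~ V v)%:R) (fun v => S v ^+ 2).
rewrite avgZ S2; case: (posnP (size ts)) => [->|n0]; first by rewrite mul0r.
have n0' : 0 < (size ts)%:R :> R by rewrite ltr0n.
move=> h; rewrite -(ler_pM2l n0') mulr1 mulrA -expr2; apply: h => v sv.
case Vv: (V v); first by rewrite mulr0 sqr_ge0.
rewrite mulr1 /S big_seq (eq_bigr (fun=> 1%N%:R)); last first.
  move=> t tts; rewrite /chi; case: (boolP (bent _)) => // bt.
  by rewrite (tV t v) in Vv.
by rewrite -big_seq -natr_sum sum1_size.
Qed.

(** By Markov's inequality a proportion at least u of the words has M at most 1 - u. The given
    translates of the support all miss these words, which by [bent_translates_avg] bounds their
    number by 1/u. *)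
Lemma bent_translates_size m (ts : seq (seq bool)) (M : seq bool -> R) (u : R) :
  0 < u -> u < 1 -> (forall v, 0 <= M v) -> avg m.*2 M <= 1 - 2 * u ->
  uniq ts -> (forall t, t \in ts -> size t = m.*2) ->
  (forall t v, t \in ts -> size v = m.*2 -> bent (xorw v t) -> 1 - u < M v) ->
  (size ts)%:R * u <= 1.
Proof.
move=> u0 u1 M0 avgM ut st tM.
have := @bent_translates_avg m ts (fun v => 1 - u < M v) ut st tM.
apply: le_trans; rewrite ler_wpM2l//.
have := @le_avg R m.*2 (fun v => (1 - u) * (1 - u < M v)%R%:R) M.
have -> : avg m.*2 (fun v => (~~ (1 - u < M v))%:R : R) =
    1 - avg m.*2 (fun v => (1 - u < M v)%R%:R).
  apply/eqP; rewrite eq_sym subr_eq -avgD; apply/eqP.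
  rewrite -[LHS](avg_cst m.*2); apply: eq_avg => v _.
  by case: (_ < _)%R; rewrite /= ?addr0 ?add0r.
rewrite avgZ => h; have {}h := le_trans (h _) avgM.
set A := avg _ _ in h *; have {}h : (1 - u) * A <= 1 - 2 * u.
  by apply: h => v _; case: ltP => [/ltW|]; rewrite ?mulr1 ?mulr0.
nra.
Qed.

End bent.

Definition seg a n (x : cantor_space) : seq bool := mkseq (fun i => x (a + i)%N) n.

Lemma size_seg a n x : size (seg a n x) = n. Proof. exact: size_mkseq. Qed.

Lemma pref_seg a n x : pref (a + n) x = pref a x ++ seg a n x.
Proof.
apply: (@eq_from_nth _ false).
  by rewrite size_cat !size_mkseq.
move=> i; rewrite size_pref => ian; rewrite nth_mkseq// nth_cat size_pref.
by case: ltnP => ia; rewrite nth_mkseq ?subnKC//; lia.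
Qed.

Lemma seg_agree a n x y : agree (a + n) x y -> seg a n x = seg a n y.
Proof.
move=> xy; apply/eq_in_map => i; rewrite mem_iota => /andP[_ ilt]; apply: xy.
by rewrite ltn_add2l.
Qed.

Lemma seg_add a n x y : seg a n (x + y) = xorw (seg a n x) (seg a n y).
Proof.
rewrite /seg /mkseq /xorw; elim: (iota 0 n) => //= i l ->.
by rewrite cantor_addE.
Qed.

Lemma seg_ext s t : seg (size s) (size t) (ext (s ++ t)) = t.
Proof.
apply: (@eq_from_nth _ false); rewrite size_seg// => i it.
by rewrite nth_mkseq// /ext nth_cat ltnNge leq_addr/= addKn.
Qed.

Lemma agree_ext_cat s t : agree (size s) (ext (s ++ t)) (ext s).
Proof. by move=> i ilt; rewrite /ext nth_cat ilt. Qed.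

Lemma size_flatten_le (T : Type) (n : nat) (ss : seq (seq T)) :
  all (fun s => size s <= n)%N ss -> (size (flatten ss) <= size ss * n)%N.
Proof.
elim: ss => //= s ss ih /andP[sn /ih h]; rewrite size_cat mulSn.
exact: leq_add.
Qed.

(** * Additive sets for the ideal of the closed null sets *)

Section bent_blocks.
Context {R : realType}.
Variables (f L : nat -> nat).
Hypothesis f0 : f 0 = 0%N.
Hypothesis fS : forall k, f k.+1 = (f k + (L k).*2)%N.

Definition bent_blocks : set cantor_space :=
  [set x | forall k, bent (seg (f k) (L k).*2 x)].

Lemma closed_bent_blocks : closed bent_blocks.
Proof.
apply/closed_agreeP => x xn k; have [y yE xy] := xn (f k.+1).
by rewrite (@seg_agree _ _ x y) ?yE// -fS.
Qed.

(** Each further block at least halves the measure, [bent] being true on at most half of the words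
    of even length. *)
Lemma haar_bent_blocks : @haar R bent_blocks = 0%E.
Proof.
pose B n := [set x | forall k, (k < n)%N -> bent (seg (f k) (L k).*2 x)].
have fle k n : (k <= n)%N -> (f k <= f n)%N.
  elim: n => [|n ih]; first by rewrite leqn0 => /eqP ->.
  rewrite leq_eqVlt => /predU1P[->//|/ih h]; rewrite fS.
  exact: leq_trans h (leq_addr _ _).
have dB n : determined (f n) (B n).
  move=> x y xy Bx k kn; rewrite -(@seg_agree _ _ x y) ?Bx//.
  by apply: agree_le xy; rewrite -fS fle.
have avgB n : avg (f n) (fun s => \1_(B n) (ext s)) <= 2^-1 ^+ n :> R.
  elim: n => [|n ih].
    by rewrite f0 /= expr0 indicE; case: (_ \in _).
  rewrite fS avg_cat exprS; apply: (@le_trans _ _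
     (avg (f n) (fun s => 2^-1 * \1_(B n) (ext s)))); last first.
    by rewrite avgZ ler_pM2l// invr_gt0.
  apply: le_avg => s sn.
  apply: (@le_trans _ _ (avg (L n).*2 (fun t => \1_(B n) (ext s) * (bent t)%:R))).
    apply: le_avg => t tn; rewrite [leLHS]indicE; case: (boolP (_ \in B n.+1)).
      rewrite inE => Bst; have := Bst n (ltnSn n); rewrite -sn -tn seg_ext => ->.
      rewrite mulr1 indicE mem_set// => k kn.
      rewrite -(@seg_agree _ _ (ext (s ++ t))); first by apply: Bst; exact: ltnW.
      apply: (@agree_le _ (size s)); last exact: agree_ext_cat.
      by rewrite -fS sn fle.
    by move=> _; rewrite mulr_ge0// indicE; case: (_ \in _).
  rewrite avgZ mulrC ler_wpM2r ?avg_bent_le//.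
apply: haar_eq0 => n; apply: (@le_trans _ _ (@haar R (B n))).
  apply: haar_le; first by apply: measurable_closed; exact: closed_bent_blocks.
    exact: measurable_determined (dB n).
  by move=> x xE k _.
rewrite (haar_determined (dB n)) lee_fin; apply: le_trans (avgB n) _.
by rewrite ler_peMl ?exprn_ge0// ler1n.
Qed.

End bent_blocks.

Lemma null_closed_additive_groupably_covered (R : realType) X :
  additive_for (null_closed_ideal R) X -> forall h, groupably_covered X h.
Proof.
move=> Xadd; apply: groupably_covered_incr => h hi.
(* The second factor bounds the number of dangerous segments of the k-th block ([sU]), the first
   counts the prefixes put before them. The block length is even, as [bent] requires, and large
   enough for every cylinder of the k-th list. *)
pose step (fs : nat * nat) k := (fs.2 + 2 ^ fs.1 * (2 ^ fs.1 * 2 ^ k.+2))%N.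
pose fs := fix fs k := if k is k'.+1 then
  ((fs k').1 + (h (step (fs k') k')).+1.*2, step (fs k') k')%N else (0, 0)%N.
pose f k := (fs k).1; pose s k := (fs k).2; pose L k := (h (s k.+1)).+1.
have fS k : f k.+1 = (f k + (L k).*2)%N by [].
have sS k : s k.+1 = (s k + 2 ^ f k * (2 ^ f k * 2 ^ k.+2))%N by [].
have fi : incr f by move=> k; rewrite fS /L; lia.
have si : incr s by move=> k; rewrite sS -[ltnLHS]addn0 ltn_add2l -!expnD expn_gt0.
have hf k : (h (s k.+1) <= f k.+1)%N by rewrite fS /L; lia.
have f0 : f 0 = 0%N by [].
have L2 k : (2 <= (L k).*2)%N by rewrite /L; lia.
clearbody f s L; clear fs step.
have E0E : null_closed_ideal R (bent_blocks f L).
  move=> I [_]; apply; split; first exact: closed_bent_blocks.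
  exact: haar_bent_blocks.
have [d [C [dC muC XC]]] := null_closed_ideal_clopen_small (Xadd _ E0E).
(* The blocks of the j-th group determine [D j], whose measure is at most half of that of a cylinder
   of length [f (l j)]. *)
pose l := fix l j := if j is j'.+1 then maxn (l j').+1 (d (f (l j')).+1) else 0%N.
have li : incr l by move=> j /=; exact: leq_maxl.
have dl j : (d (f (l j)).+1 <= f (l j.+1))%N.
  by apply: leq_trans (incr_ge _ fi); exact: leq_maxr.
have l0 : l 0 = 0%N by [].
clearbody l.
pose D j := C (f (l j)).+1.
have dD j : determined (f (l j.+1)) (D j) by exact: determined_le (dl j) (dC _).
(* M j r is the proportion of the extensions of r that lie in D j; the bounds
   b k on it along a branch increase slowly to 1. *)
pose M j r : R := avg (f (l j.+1) - size r) (fun v => \1_(D j) (ext (r ++ v))).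
have M0 j r : 0 <= M j r.
  by apply: avg_ge0 => v _; rewrite indicE; case: (_ \in _).
pose b k : R := 1 - 2^-1 ^+ k.+1.
have /choice[jj jjP] : forall k, exists j, (l j <= k < l j.+1)%N.
  by move=> k; apply: incr_block => //; rewrite l0.
have jjE j k : (l j <= k < l j.+1)%N -> jj k = j.
  by move=> kj; exact: incr_block_uniq li (jjP k) kj.
(* [T k r] collects the segments t of x that are dangerous after r: every continuation of x + y by t
   plus a word of the support raises the proportion above [b k.+1]. *)
pose T k r := [seq t <- words (L k).*2 | `[< forall v, size v = (L k).*2 ->
  bent (xorw v t) -> b k.+1 < M (jj k) (r ++ v) >]].
pose U k := flatten [seq T k r | r <- words (f k) & M (jj k) r <= b k].
have M_step k r : size r = f k ->
    M (jj k) r = avg (L k).*2 (fun v => M (jj k) (r ++ v)).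
  move=> rk; rewrite /M rk; have /andP[_ kl] := jjP k.
  have := incr_leq fi kl; rewrite fS => fk.
  rewrite (_ : f _ - f k =
    (L k).*2 + (f (l (jj k).+1) - (f k + (L k).*2)))%N; last by lia.
  rewrite avg_cat; apply: eq_avg => v vk; rewrite size_cat rk vk.
  by apply: eq_avg => w _; rewrite catA.
have sU k : (size (U k) <= 2 ^ f k * 2 ^ k.+2)%N.
  apply: leq_trans (@size_flatten_le _ (2 ^ k.+2) _ _) _; last first.
    by rewrite size_map leq_mul// -(size_words (f k)) size_filter count_size.
  apply/allP => _ /mapP[r + ->]; rewrite mem_filter mem_words => /andP[Mr /eqP rk].
  (* With u = [2^-1 ^+ k.+2], [b k] is 1 - 2u and [b k.+1] is 1 - u, hence at most [2 ^ k.+2]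
     segments. *)
  have u0 : 0 < 2^-1 ^+ k.+2 :> R by rewrite exprn_gt0.
  have u1 : 2^-1 ^+ k.+2 < 1 :> R by rewrite exprn_ilt1// invf_lt1// ltr1n.
  have := @bent_translates_size R (L k) (T k r) (fun v => M (jj k) (r ++ v)) _ u0 u1.
  rewrite -M_step// => Tk; rewrite -(@ler_nat R) natrX -(ler_pM2r u0).
  rewrite -[leRHS]exprMn mulfV// expr1n; apply: Tk => //.
  - by rewrite (le_trans Mr)// /b [in X in _ <= X]exprS mulrA mulfV// mul1r.
  - by rewrite filter_uniq// words_uniq.
  - by move=> t; rewrite mem_filter mem_words => /andP[_ /eqP].
  - by move=> t v; rewrite mem_filter => /andP[/asboolP h' _]; exact: h'.
pose W k := [seq ext (r ++ t) | r <- words (f k), t <- U k].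
have sW k : (size (W k) <= s k.+1 - s k)%N.
  by rewrite size_allpairs size_words sS addKn leq_mul2l sU orbT.
apply: (@groupably_covered_lists X h s l W) => //.
move=> x Xx; apply: contrapT => nN.
(* If x is not covered, it avoids the dangerous segments throughout infinitely many groups; y is
   then built in the closed null set so that x + y escapes [D j] for each of them. *)
pose fail j := forall k, (l j <= k < l j.+1)%N -> seg (f k) (L k).*2 x \notin U k.
have failP N : exists2 j, (N <= j)%N & fail j.
  apply: contrapT => nf; apply: nN; exists N => j Nj.
  have [k kj xU] : exists2 k, (l j <= k < l j.+1)%N &
      seg (f k) (L k).*2 x \in U k.
    apply: contrapT => nk; apply: nf; exists j => // k kj; apply/negP => xU.
    by apply: nk; exists k.
  have : ext (pref (f k) x ++ seg (f k) (L k).*2 x) \in W k.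
    by apply: (allpairs_f (fun r t => ext (r ++ t))); rewrite ?mem_words ?size_pref.
  move=> /(nthP 0)[i iW xi]; exists k, i; split=> //.
  rewrite xi -pref_seg -fS; apply: agree_le (@agree_pref _ _).
  apply: leq_trans (hf k); apply: incr_leq => //.
  by have := leq_trans iW (sW k); lia.
have splice e k v : size v = (L k).*2 ->
    exists2 e', agree (f k) e e' & seg (f k) (L k).*2 e' = v.
  move=> vk; exists (ext (pref (f k) e ++ v)).
    apply: agree_sym; apply: agree_trans (agree_pref e).
    by rewrite -{1}(size_pref (f k) e); exact: agree_ext_cat.
  by have := seg_ext (pref (f k) e) v; rewrite size_pref vk.
have bl k : b k.+1 < 1 by rewrite /b ltrBlDr ltrDl exprn_gt0.
have stage j e : exists e', [/\ agree (f (l j)) e e',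
    forall k, (l j <= k < l j.+1)%N -> bent (seg (f k) (L k).*2 e') &
    fail j -> ~ D j (x + e')].
  have fl : (f (l j) <= f (l j.+1))%N by apply: incr_leq => //; exact: ltnW.
  have inner n : (l j + n <= l j.+1)%N -> exists e', [/\ agree (f (l j)) e e',
      forall k, (l j <= k < l j + n)%N -> bent (seg (f k) (L k).*2 e') &
      fail j -> M j (pref (f (l j + n)%N) (x + e')) <= b (l j + n)%N].
    elim: n => [|n ih] nj.
      exists e; split=> //; first by move=> k; lia.
      rewrite addn0 => _.
      (* A single prefix of length [f (l j)] accounts for at most [2 ^+ f (l j)] times the mean,
         here at most 1/2, which is at most [b (l j)]. *)
      apply: le_trans (avg_ge_point (M0 j) (size_pref _ _)) _.
      have -> : avg (f (l j)) (M j) = avg (f (l j.+1)) (fun r => \1_(D j) (ext r)).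
        by rewrite -[in RHS](subnKC fl) avg_cat; apply: eq_avg => r rj; rewrite /M rj.
      have := muC (f (l j)).+1; rewrite -/(D j) (haar_determined (dD j)) lee_fin.
      have p0 : 0 < 2 ^+ f (l j) :> R by rewrite exprn_gt0.
      rewrite -(ler_pM2l p0) exprS mulrCA exprVn mulfV ?gt_eqF// mulr1.
      move=> /le_trans; apply; rewrite /b exprS.
      have : 2^-1 ^+ l j <= 1 :> R by rewrite exprn_ile1// invf_le1// ler1n.
      lra.
    have [|e' [ee' e'b e'M]] := ih; first by rewrite addnS in nj; exact: ltnW.
    set k := (l j + n)%N in e'b e'M *.
    have kj : (l j <= k < l j.+1)%N by rewrite /k leq_addr -addnS.
    pose t := seg (f k) (L k).*2 x; pose r := pref (f k) (x + e').
    (* v is the next segment of x + y, so y receives v + t, which must lie in the support. In a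
       failing group t is not dangerous and some v keeps the proportion low; in another group any
       word of the support serves. *)
    have [v [vk vb vM]] : exists v, [/\ size v = (L k).*2, bent (xorw v t) &
        fail j -> M j (r ++ v) <= b k.+1].
      have [fj|nf] := pselect (fail j).
        apply: contrapT => nv; have /negP := fj k kj; apply.
        apply/flatten_mapP; exists r.
          by rewrite mem_filter mem_words size_pref eqxx (jjE _ _ kj) e'M.
        rewrite mem_filter mem_words size_seg eqxx andbT; apply/asboolP => v vk vb.
        rewrite (jjE _ _ kj) ltNge; apply/negP => vM; apply: nv.
        by exists v; split.
      pose u := true :: true :: nseq ((L k).*2 - 2) false.
      have su : size u = (L k).*2 by rewrite /= size_nseq; have := L2 k; lia.
      have sut : size u = size t by rewrite su size_seg.
      exists (xorw u t); split=> //; first by rewrite size_xorw// size_seg.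
      by rewrite xorwKr// bent_true.
    have svt : size v = size t by rewrite vk size_seg.
    have [|e'' e'e'' e''v] := splice e' k (xorw v t).
      by rewrite size_xorw// size_seg.
    exists e''; rewrite addnS -/k; split.
    - apply: agree_trans ee' (agree_le _ e'e''); apply: incr_leq => //.
      exact: leq_addr.
    - move=> k' /andP[jk']; rewrite ltnS leq_eqVlt => /predU1P[->|k'k].
        by rewrite e''v.
      rewrite -(@seg_agree _ _ e'); first by apply: e'b; rewrite jk'.
      by apply: agree_le e'e''; rewrite -fS; exact: incr_leq.
    - move=> /vM; rewrite fS pref_seg seg_add e''v xorwK//.
      rewrite (_ : pref (f k) (x + e'') = r)//.
      by apply: pref_agree; apply: agreeD => //; exact: agree_sym.
  have [|e' [ee' e'b e'M]] := inner (l j.+1 - l j)%N; rewrite ?subnKC ?(ltnW (li j))//.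
  rewrite subnKC ?(ltnW (li j))// in e'b e'M.
  exists e'; split=> // fj De'; move: (e'M fj).
  (* At the end of the group no coordinate is left free: M is the indicator of [D j], and being
     below 1 it is 0. *)
  rewrite /M size_pref subnn /= cats0 indicE mem_set; last first.
    by apply: dD De'; exact/agree_sym/agree_pref.
  have l1 : (0 < l j.+1)%N by have := li j; lia.
  by rewrite -(prednK l1) leNgt bl.
have /choice[st stP] := fun je : nat * cantor_space => stage je.1 je.2.
pose e := fix e j := if j is j'.+1 then st (j', e j') else 0 : cantor_space.
have [y yP] : exists y, forall j, agree ((f \o l) j) y (e j).
  apply: agree_limit; first exact: incr_comp.
  by move=> j; have [] := stP (j, e j).
have xyX : set_add X (bent_blocks f L) (x + y).
  exists x => //; exists y => // k; have [_ + _] := stP (jj k, e (jj k)).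
  move=> /(_ k (jjP k)); rewrite (@seg_agree _ _ y (e (jj k).+1))// -fS.
  apply: agree_le (yP _) => /=; have /andP[_] := jjP k; exact: incr_leq.
have [N NP] := XC _ xyX; have [j Nj jf] := failP N.
have [_ _ /(_ jf)] := stP (j, e j); apply.
have : D j (x + y).
  by apply: NP; have := incr_ge j li; have := incr_ge (l j) fi; lia.
by apply: dD => i ij; rewrite !cantor_addE (yP j.+1).
Qed.

(** * Covers of sets of small Hausdorff dimension *)

Section hausdorff.
Context {R : realType} {T : metricType R}.
Implicit Types A : set T.

Lemma diam_ge0 A : (0 <= diam A)%E.
Proof. by apply: ereal_sup_ubound; left. Qed.

Lemma diam_ge A x y : A x -> A y -> ((mdist x y)%:E <= diam A)%E.
Proof. by move=> Ax Ay; apply: ereal_sup_ubound; right; exists x => //; exists y. Qed.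

Lemma diam_le A (e : R) : 0 <= e ->
  (forall x y, A x -> A y -> mdist x y <= e) -> (diam A <= e%:E)%E.
Proof.
move=> e0 Ae; apply: ge_ereal_sup => _ [->|[x Ax [y Ay <-]]];
by rewrite lee_fin ?Ae.
Qed.

Lemma open_mdist_ball (x : T) (r : R) : open (ball x r).
Proof.
rewrite openE => y; rewrite ballEmdist/= => xy; apply/nbhs_ballP.
exists (r - mdist x y) => /=; first by rewrite subr_gt0.
move=> z; rewrite !ballEmdist/= => yz.
by have := metric_triangle x y z; lra.
Qed.

Lemma hausdorff_dim_ge0 A : (0 <= hausdorff_dim A)%E.
Proof. by apply: le_ereal_inf_tmp => _ [s [s0 _] <-]; rewrite lee_fin ltW. Qed.

Lemma hausdorff_null_cover (s : R) A : 0 < s -> s <= 1 ->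
  hausdorff_measure s A = 0%E -> forall e : R, 0 < e -> e <= 1 ->
  exists (E : nat -> set T) (d : nat -> R), [/\ A `<=` \bigcup_n E n,
    forall n, diam (E n) = (d n)%:E & forall N, \sum_(0 <= n < N) d n <= e].
Proof.
move=> s0 s1 HA e e0 e1.
have : (hausdorff_premeasure 1 s A < e%:E)%E.
  apply: (@le_lt_trans _ _ 0%E); last by rewrite lte_fin.
  by rewrite -HA; apply: ereal_sup_ubound; exists 1 => //=.
move=> /ereal_inf_lt[_ [E [AE E1] <-] sE].
have Efin n : diam (E n) \is a fin_num.
  by rewrite ge0_fin_numE ?diam_ge0//; apply: le_lt_trans (E1 n) _; exact: ltry.
exists E, (fun n => fine (diam (E n))); split=> // [n|N]; first by rewrite fineK.
rewrite -lee_fin -sumEFin; apply: le_trans (ltW sE).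
apply: (@le_trans _ _ (\sum_(0 <= n < N) diam (E n) `^ s)%E); last first.
  by apply: nneseries_lim_ge => n _ _; exact: poweR_ge0.
apply: lee_sum => n _; rewrite fineK//.
have := diam_ge0 (E n); have := E1 n; rewrite -(fineK (Efin n)).
move: (fine _) => r; rewrite poweR_EFin !lee_fin => r1.
rewrite le_eqVlt => /predU1P[<-|r0]; first exact: powR_ge0.
by rewrite -{1}(powRr1 (ltW r0)); apply: ger_powR; rewrite ?r0.
Qed.

Lemma hausdorff_null_open_cover (s : R) A : 0 < s -> s <= 1 ->
  hausdorff_measure s A = 0%E -> forall e : R, 0 < e -> e <= 1 ->
  exists (O : nat -> set T) (a : nat -> R),
    [/\ forall n, open (O n), A `<=` \bigcup_n O n, forall n, 0 < a n,
      forall N, \sum_(0 <= n < N) a n <= e &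
      forall n x y, O n x -> O n y -> mdist x y < a n].
Proof.
move=> s0 s1 HA e e0 e1.
have e20 : 0 < e / 2 by rewrite divr_gt0.
have e21 : e / 2 <= 1 by lra.
have [E [d [AE dE sd]]] := hausdorff_null_cover s0 s1 HA e20 e21.
(* Enlarging by [r n] costs 2 [r n] in diameter, at most e / 2 in total. *)
pose r n := e / 8 * 2^-1 ^+ n.
have r0 n : 0 < r n by rewrite mulr_gt0 ?exprn_gt0// divr_gt0.
have d0 n : 0 <= d n by rewrite -lee_fin -dE diam_ge0.
have sr N : \sum_(0 <= n < N) 2 * r n <= e / 2 - e / 2 * 2^-1 ^+ N.
  elim: N => [|N ih]; first by rewrite big_nil expr0 mulr1 subrr.
  by rewrite big_nat_recr//= exprS; rewrite /r; lra.
exists (fun n => \bigcup_(y in E n) ball y (r n)), (fun n => d n + 2 * r n); split.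
- by move=> n; apply: bigcup_open => y _; exact: open_mdist_ball.
- move=> x /AE[n _ Ex]; exists n => //; exists x => //; exact: ballxx.
- by move=> n; have := d0 n; have := r0 n; lra.
- move=> N; rewrite big_split/=; have := sd N; have := sr N.
  have : 0 <= e / 2 * 2^-1 ^+ N by rewrite mulr_ge0 ?exprn_ge0// ltW.
  lra.
- move=> n x y [x' Ex' +] [y' Ey' +]; rewrite !ballEmdist/= => xx' yy'.
  have := metric_triangle x x' y; have := metric_triangle x' y' y.
  have : mdist x' y' <= d n by rewrite -lee_fin -dE; exact: diam_ge.
  rewrite (metric_sym x x'); lra.
Qed.

Lemma hausdorff_measure_ge0 (s : R) A : (0 <= hausdorff_measure s A)%E.
Proof.
apply: (@le_trans _ _ (hausdorff_premeasure 1 s A)).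
  apply: le_ereal_inf_tmp => _ [E _ <-].
  by apply: nneseries_ge0 => n _ _; exact: poweR_ge0.
by apply: ereal_sup_ubound; exists 1 => //=.
Qed.

Lemma diam_poweR_le (s : R) A (e : R) : 0 < s -> 0 <= e ->
  (forall x y, A x -> A y -> mdist x y <= e) -> (diam A `^ s <= (e `^ s)%:E)%E.
Proof.
move=> s0 e0 Ae; have := diam_le e0 Ae; have := diam_ge0 A.
case: (diam A) => [r| |]; rewrite ?leey_eq ?leeNy_eq// poweR_EFin !lee_fin => r0 re.
by apply: ge0_ler_powR; rewrite ?nnegrE ?(ltW s0).
Qed.

End hausdorff.

(** In decreasing order the k-th term is at most each of the first [k.+1] terms, whose sum is at
    most e. *)
Lemma sort_decreasing_le (R : realType) (a : nat -> R) N (e : R) :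
  (forall n, 0 < a n) -> \sum_(0 <= n < N) a n <= e ->
  exists p : seq nat, perm_eq p (iota 0 N) /\
    forall k, (k < N)%N -> (k.+1)%:R * a (nth 0%N p k) <= e.
Proof.
move=> a0 ae; pose r : rel nat := fun i j => a j <= a i.
have rtot : total r by move=> i j; exact: le_total.
have rtr : transitive r by move=> i j k ji ik; exact: le_trans ik ji.
have rrefl : reflexive r by move=> i; exact: lexx.
pose p := sort r (iota 0 N).
have pp : perm_eq p (iota 0 N) by rewrite perm_sort.
have sp : size p = N by rewrite (perm_size pp) size_iota.
exists p; split=> // k kN; apply: le_trans ae.
rewrite (_ : \sum_(0 <= n < N) a n = \sum_(n <- p) a n); last first.
  by rewrite (perm_big _ pp) /index_iota subn0.
rewrite -(cat_take_drop k.+1 p) big_cat/= -[leLHS]addr0 lerD//; last first.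
  by apply: sumr_ge0 => n _; exact: ltW.
rewrite nth_cat size_takel ?sp// ltnSn nth_take//.
rewrite (big_nth 0%N) size_takel ?sp// mulr_natl -[X in _ *+ X]subn0 -sumr_const_nat.
rewrite !big_mkord; apply: ler_sum => i _; rewrite nth_take//.
apply: (@sorted_leq_nth _ r rtr rrefl 0%N p (sort_sorted rtot _)); rewrite ?inE ?sp//.
  by apply: leq_ltn_trans kN; rewrite -ltnS.
by rewrite -ltnS.
Qed.

(** * A metric on the Cantor space with slowly shrinking cylinders *)

Section slow_metric.
Context {R : realType} {h : nat -> nat}.

(** The open ball of radius 1/(k+1) is the cylinder of length [h k], however fast h grows. *)
Definition slow_dist (x y : cantor_space) : R :=
  if pselect (exists k, `[< ~ agree (h k) x y >]) is left xy
  then (ex_minn xy).+1%:R^-1 else 0.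

Hypothesis hi : incr h.

Lemma slow_dist_lt k x y : slow_dist x y < k.+1%:R^-1 <-> agree (h k) x y.
Proof.
rewrite /slow_dist; case: pselect => [xy|xy]; last first.
  split=> _; last by rewrite invr_gt0 ltr0n.
  by apply: contrapT => nxy; apply: xy; exists k; apply/asboolP.
case: ex_minnP => m /asboolP mxy mmin; rewrite ltf_pV2 ?posrE ?ltr0n// ltr_nat ltnS.
split=> [km|ag].
  by apply: contrapT => /asboolP/mmin; rewrite leqNgt km.
rewrite ltnNge; apply/negP => mk; apply: mxy; apply: agree_le ag.
exact: incr_leq.
Qed.

Lemma slow_dist_ge0 x y : 0 <= slow_dist x y.
Proof. by rewrite /slow_dist; case: pselect => // ?; rewrite invr_ge0. Qed.

Lemma slow_distxx x : slow_dist x x = 0.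
Proof.
rewrite /slow_dist; case: pselect => // -[k xx]; exfalso.
by move: xx => /asboolP; apply.
Qed.

Lemma slow_dist_eq0 x y : slow_dist x y = 0 -> x = y.
Proof.
move=> xy; apply: agreeP => n; apply: (@agree_le _ (h n)); first exact: incr_ge.
by apply/slow_dist_lt; rewrite xy invr_gt0 ltr0n.
Qed.

Lemma slow_dist_cases x y : slow_dist x y = 0 \/
  exists2 k, slow_dist x y = k.+1%:R^-1 & ~ agree (h k) x y.
Proof.
rewrite /slow_dist; case: pselect => [xy|_]; last by left.
by right; case: ex_minnP => k /asboolP nxy _; exists k.
Qed.

Lemma slow_distC x y : slow_dist x y = slow_dist y x.
Proof.
have le z t : slow_dist z t <= slow_dist t z.
  have [->|[k -> nzt]] := slow_dist_cases z t; first exact: slow_dist_ge0.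
  by rewrite leNgt; apply/negP => /slow_dist_lt/agree_sym.
by apply/eqP; rewrite eq_le !le.
Qed.

Lemma slow_dist_triangle y x z : slow_dist x z <= slow_dist x y + slow_dist y z.
Proof.
have [->|[k -> nxz]] := slow_dist_cases x z.
  by rewrite addr_ge0// slow_dist_ge0.
have [xy|xy] := ltP (slow_dist x y) k.+1%:R^-1; last first.
  by rewrite -[leLHS]addr0 lerD// slow_dist_ge0.
have [yz|yz] := ltP (slow_dist y z) k.+1%:R^-1; last first.
  by rewrite -[leLHS]add0r lerD// slow_dist_ge0.
exfalso; apply: nxz.
by move/slow_dist_lt : xy => /agree_trans; apply; exact/slow_dist_lt.
Qed.

End slow_metric.

(* An alias of the Cantor space, to carry another metric than the inherited
   one. *)
Definition slow_cantor (R : realType) (h : nat -> nat) (hi : incr h) : Type :=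
  cantor_space.

HB.instance Definition _ (R : realType) h (hi : incr h) :=
  gen_eqMixin (slow_cantor R hi).
HB.instance Definition _ (R : realType) h (hi : incr h) :=
  gen_choiceMixin (slow_cantor R hi).
HB.instance Definition _ (R : realType) h (hi : incr h) :=
  @isMetric.Build R (slow_cantor R hi) (@slow_dist R h) slow_distxx
    (slow_dist_eq0 hi) (slow_distC hi) (slow_dist_triangle hi).

(** The n-th group concatenates lists for [Y 0], ..., [Y n]. The offset M is arbitrary because each
    list comes after all the previous ones. *)
Lemma groupably_covered_union X h (Y : nat -> set cantor_space) :
  X `<=` \bigcup_m Y m ->
  (forall m M, exists l : seq cantor_space, forall x, Y m x ->
    exists2 k, (k < size l)%N & agree (h (M + k)%N) (nth 0 l k) x) ->
  groupably_covered X h.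
Proof.
move=> XY Yl.
have /choice[st stP] : forall nM : nat * nat, exists l : seq cantor_space,
    forall m x, (m < nM.1)%N -> Y m x ->
    exists2 k, (k < size l)%N & agree (h (nM.2 + k)%N) (nth 0 l k) x.
  move=> [n M] /=; elim: n => [|n [l lP]]; first by exists [::].
  have [l' l'P] := Yl n (M + size l)%N.
  exists (l ++ l') => m x; rewrite ltnS leq_eqVlt => /predU1P[->|mn].
    move=> /l'P[k kl xk]; exists (size l + k)%N.
      by rewrite size_cat ltn_add2l.
    by rewrite nth_cat ltnNge leq_addr /= addKn addnA.
  move=> /(lP m x mn)[k kl xk]; exists k.
    by rewrite size_cat ltn_addr.
  by rewrite nth_cat kl.
pose s := fix s n := if n is n'.+1 then
  (s n' + size (st (n'.+1, s n'))).+1 else 0%N.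
apply: (@groupably_covered_lists X h s id (fun n => st (n.+1, s n))) => //.
- by move=> n /=; rewrite ltnS leq_addr.
- by move=> n /=; lia.
move=> x /XY[m _ Ymx]; exists m => n mn.
have [k kl xk] := stP (n.+1, s n) m x mn Ymx.
by exists n, k; split => //; rewrite leqnn /=.
Qed.

Lemma upper_hausdorff_null_groupably_covered (R : realType) X :
  @upper_hausdorff_null R cantor_space X -> forall h, groupably_covered X h.
Proof.
move=> Xnull; apply: groupably_covered_incr => h hi.
pose S := slow_cantor R hi; pose f : cantor_space -> S := id.
have uf : unif_continuous_on X f.
  move=> e e0; have [k ke] : exists k, k.+1%:R^-1 < e :> R.
    exists (Num.truncn e^-1); rewrite -[ltRHS]invrK ltf_pV2 ?posrE ?invr_gt0 ?ltr0n//.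
    exact: truncnS_gt.
  exists (2^-1 ^+ h k); first by rewrite exprn_gt0.
  move=> x y _ _ xy; apply: lt_trans ke; apply/(slow_dist_lt hi).
  by move/cantor_dist_lt : xy; apply: agree_le.
have : (upper_hausdorff_dim (f @` X) < 1)%E by rewrite Xnull// lte_fin.
move=> /ereal_inf_lt[_ [Z [i [C [K [[_ isoi _] [F cF KF] XK _ ->]]]]]].
move=> /ereal_inf_lt[_ [s [s0 HK] <-]]; rewrite lte_fin => s1.
apply: (@groupably_covered_union X h (fun m => X `&` (i \o f) @^-1` F m)).
  move=> x Xx; have : K (i (f x)) by apply: XK; exists (f x) => //; exists x.
  by rewrite KF => -[m _ Fm]; exists m.
move=> m M; have e0 : 0 < M.+1%:R^-1 :> R by rewrite invr_gt0 ltr0n.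
have e1 : M.+1%:R^-1 <= 1 :> R by rewrite invf_le1 ?ltr0n// ler1n.
have [U [a [oU KO a0 sa Oa]]] := hausdorff_null_open_cover s0 (ltW s1) HK e0 e1.
have [N FN] : exists N, F m `<=` \bigcup_(k in [set k | (k < N)%N]) U k.
  apply: compact_incr_cover => // z Fz; apply: KO; rewrite KF; by exists m.
(* In sorted order the k-th set has diameter at most 1/((M+1)(k+1)), hence at most 1/(M+k+1): its
   points coming from X agree on [h (M + k)] coordinates. *)
have [p [pp pa]] := sort_decreasing_le a0 (sa N).
have /choice[c cP] : forall k, exists c, forall x, X x -> U k (i (f x)) ->
    X c /\ U k (i (f c)).
  move=> k; have [[c cP]|nc] := pselect (exists c, X c /\ U k (i (f c))).
    by exists c.
  by exists 0 => x Xx Ox; exfalso; apply: nc; exists x.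
exists [seq c k | k <- p] => x [Xx /= /FN[n nN Onx]].
have sp : size p = N by rewrite (perm_size pp) size_iota.
have np : n \in p by rewrite (perm_mem pp) mem_iota.
have ip : (index n p < N)%N by rewrite -sp index_mem.
exists (index n p); first by rewrite size_map index_mem.
rewrite (nth_map 0%N) ?index_mem// nth_index//; apply/(slow_dist_lt hi).
have [Xc Oc] := cP n x Xx Onx.
have := Oa n _ _ Oc Onx; rewrite isoi; [|by exists (c n)|by exists x].
move=> /lt_le_trans; apply; have := pa _ ip; rewrite nth_index//.
set k := index n p => h1.
have k0 : 0 < k.+1%:R :> R by rewrite ltr0n.
have Mk0 : 0 < (M + k).+1%:R :> R by rewrite ltr0n.
rewrite -[leRHS]mul1r ler_pdivlMr//.
have M0 : 0 < M.+1%:R :> R by rewrite ltr0n.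
move: h1; rewrite -[leRHS]mul1r ler_pdivlMr//; apply: le_trans.
rewrite (_ : _ * _ * M.+1%:R = a n * (k.+1 * M.+1)%:R); last by rewrite natrM; ring.
by rewrite ler_pM2l// ler_nat mulSn mulnS; lia.
Qed.

(** * Embedding into a complete space of functions *)

Lemma min_le_add (R : realType) (c a b d : R) : 0 < c -> 0 <= b -> 0 <= d ->
  a <= b + d -> Num.min c a <= Num.min c b + Num.min c d.
Proof.
move=> c0 b0 d0 abd; rewrite /Num.min.
by case: (ltP c a) => ?; case: (ltP c b) => ?; case: (ltP c d) => ?; lra.
Qed.

Section truncated_sup_metric.
Context {R : realType} {T : Type} (c : R).
Hypothesis c0 : 0 < c.
Implicit Types f g : T -> R.

(** Truncating at c keeps the supremum finite for unbounded functions, and 0 covers an empty T. *)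
Definition sup_dist f g : R :=
  sup (0 |` range (fun t => Num.min c `|f t - g t|)).

Let has_sup_dist f g : has_sup (0 |` range (fun t => Num.min c `|f t - g t|)).
Proof.
split; first by exists 0; left.
by exists c => _ [->|[t _ <-]]; rewrite ?ge_min ?lexx// ltW.
Qed.

Lemma sup_dist_ge f g t : Num.min c `|f t - g t| <= sup_dist f g.
Proof. by apply: sup_upper_bound => //; right; exists t. Qed.

Lemma sup_dist_le f g (e : R) : 0 <= e ->
  (forall t, Num.min c `|f t - g t| <= e) -> sup_dist f g <= e.
Proof.
move=> e0 fg; apply: ge_sup; first by exists 0; left.
by move=> _ [->//|[t _ <-]].
Qed.

Lemma sup_dist_ge0 f g : 0 <= sup_dist f g.
Proof. by apply: sup_upper_bound => //; left. Qed.

Lemma sup_distxx f : sup_dist f f = 0.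
Proof.
apply/eqP; rewrite eq_le sup_dist_ge0 andbT; apply: sup_dist_le => // t.
by rewrite subrr normr0 ge_min lexx orbT.
Qed.

Lemma sup_dist_eq0 f g : sup_dist f g = 0 -> f = g.
Proof.
move=> fg0; apply/funext => t; have := sup_dist_ge f g t.
rewrite fg0 ge_min leNgt c0 /= normr_le0 subr_eq0; exact/eqP.
Qed.

Lemma sup_distC f g : sup_dist f g = sup_dist g f.
Proof.
rewrite /sup_dist.
suff -> : (fun t => Num.min c `|f t - g t|) =
    (fun t => Num.min c `|g t - f t|) by [].
by apply/funext => t; rewrite distrC.
Qed.

Lemma sup_dist_triangle g f k : sup_dist f k <= sup_dist f g + sup_dist g k.
Proof.
apply: sup_dist_le; first by rewrite addr_ge0// sup_dist_ge0.
move=> t; apply: le_trans (lerD (sup_dist_ge f g t) (sup_dist_ge g k t)).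
apply: min_le_add; rewrite ?normr_ge0//; exact: ler_distD.
Qed.

End truncated_sup_metric.

Definition sup_space (R : realType) (T : Type) (c : R) (c0 : 0 < c) : Type :=
  T -> R.

HB.instance Definition _ (R : realType) (T : Type) (c : R) (c0 : 0 < c) :=
  gen_eqMixin (@sup_space R T c c0).
HB.instance Definition _ (R : realType) (T : Type) (c : R) (c0 : 0 < c) :=
  gen_choiceMixin (@sup_space R T c c0).
HB.instance Definition _ (R : realType) (T : Type) (c : R) (c0 : 0 < c) :=
  @isMetric.Build R (@sup_space R T c c0) (sup_dist c) (sup_distxx c0)
    (sup_dist_eq0 c0) (sup_distC c) (sup_dist_triangle c0).

Lemma sup_space_complete (R : realType) (T : Type) (c : R) (c0 : 0 < c) :
  complete_metric (@sup_space R T c c0).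
Proof.
move=> F PF /cauchyP cF.
have Fball e : 0 < e -> exists f0 : sup_space T c0, F [set g | forall t,
    `|f0 t - g t| < e].
  (* Below c the truncation is invisible, so a ball of radius at most c controls the actual
     differences. *)
  move=> e0; have [f0 Ff0] := cF (Num.min e c) (ltac:(by rewrite lt_min e0 c0)).
  exists f0; apply: filterS Ff0 => g; rewrite ballEmdist/= => f0g t.
  have := le_lt_trans (sup_dist_ge c0 f0 g t) f0g.
  by rewrite gt_min !lt_min ltxx andbF /= => /andP[].
have Fcvg t : exists l : R, (f t) @[f --> F] --> l.
  have : cauchy (f t @[f --> F]).
    apply: cauchy_exP => e e0; have [f0 Ff0] := Fball e e0.
    exists (f0 t); change (F [set g | ball (f0 t) e (g t)]).
    by apply: filterS Ff0 => g; exact.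
  by move=> /cauchy_cvg/cvg_ex[l lP]; exists l.
have [l lP] := choice Fcvg.
exists l; apply/cvg_ballP => e e0 /=.
have e40 : 0 < e / 4 by rewrite divr_gt0.
have [f0 Ff0] := Fball _ e40.
apply: filterS (Ff0) => g gf0; rewrite ballEmdist/=.
apply: (@le_lt_trans _ _ (3 * (e / 4))); last by lra.
apply: sup_dist_le => //; first by rewrite mulr_ge0// ltW.
move=> t; rewrite ge_min; apply/orP; right.
move/cvgrPdist_lt : (lP t) => /(_ _ e40) Fl.
have [k [kf0 kl]] := filter_ex (filterI Ff0 Fl).
have := kf0 t; have := gf0 t; move: kl => /=.
rewrite !ltr_norml !ler_norml => /andP[? ?] /andP[? ?] /andP[? ?].
by apply/andP; split; lra.
Qed.

(** The difference of the distance functions of x and y is at most the distance of x and y, with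
    equality at the point y; the bound c makes the truncation harmless. *)
Lemma kuratowski_isometry (R : realType) (Y : metricType R) (S : set Y) (c : R)
    (c0 : 0 < c) : (forall x y, S x -> S y -> mdist x y <= c) ->
  forall x y, S x -> S y ->
  mdist (mdist x : sup_space Y c0) (mdist y : sup_space Y c0) = mdist x y.
Proof.
move=> Sc x y Sx Sy; apply/eqP; rewrite eq_le; apply/andP; split.
  apply: sup_dist_le => //; first exact: mdist_ge0.
  move=> t; rewrite ge_min; apply/orP; right.
  have := metric_triangle x y t; have := metric_triangle y x t.
  by rewrite (metric_sym y x) ler_norml => ? ?; apply/andP; split; lra.
apply: le_trans (sup_dist_ge c0 _ _ y).
by rewrite mdistxx subr0 ger0_norm ?mdist_ge0// le_min Sc/=.
Qed.

(** * Dimension of uniformly continuous images *)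

Lemma unif_continuous_agree (R : realType) (X : set cantor_space)
    (Y : metricType R) (f : cantor_space -> Y) :
  @unif_continuous_on R cantor_space Y X f ->
  forall e : R, 0 < e -> exists n, forall x y, X x -> X y -> agree n x y ->
    mdist (f x) (f y) < e.
Proof.
move=> uf e /uf[d d0 fd].
have [n nd] := half_expn_lt d0.
exists n.+1 => x y Xx Xy xy; apply: fd => //.
by apply: lt_trans nd; apply/cantor_dist_lt.
Qed.

(** X meets finitely many cylinders of a length n on which the image varies by less than 1; c sums
    the distances from one image point to a representative of each. *)
Lemma unif_continuous_bounded (R : realType) (X : set cantor_space)
    (Y : metricType R) (f : cantor_space -> Y) :
  @unif_continuous_on R cantor_space Y X f ->
  exists2 c : R, 0 < c & forall x y, X x -> X y -> mdist (f x) (f y) <= c.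
Proof.
move=> /unif_continuous_agree/(_ 1 ltr01)[n nf].
have [->|/set0P[x0 Xx0]] := eqVneq X set0; first by exists 1.
have /choice[rep repP] : forall r, exists y, forall x, X x -> pref n x = r ->
    X y /\ pref n y = r.
  move=> r; have [[y yP]|ny] := pselect (exists y, X y /\ pref n y = r).
    by exists y.
  by exists 0 => x Xx xr; exfalso; apply: ny; exists x.
pose c := \sum_(r <- words n) mdist (f x0) (f (rep r)).
have c0 : 0 <= c by apply: sumr_ge0 => r _; exact: mdist_ge0.
have xc x : X x -> mdist (f x0) (f x) <= c + 1.
  move=> Xx; have [Xr rx] := repP (pref n x) x Xx erefl.
  have xr : agree n (rep (pref n x)) x.
    move=> i ilt; have := congr1 (fun s => nth false s i) rx.
    by rewrite !nth_mkseq.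
  have := nf _ _ Xr Xx xr; have := metric_triangle (f x0) (f (rep (pref n x))) (f x).
  have : mdist (f x0) (f (rep (pref n x))) <= c.
    rewrite /c (bigD1_seq (pref n x)) ?words_uniq ?mem_words ?size_pref//=.
    by rewrite lerDl; apply: sumr_ge0 => r _; exact: mdist_ge0.
  lra.
exists (2 * (c + 1)); first by rewrite mulr_gt0// ltr_wpDl.
move=> x y Xx Xy; have := metric_triangle (f x) (f x0) (f y).
by have := xc x Xx; have := xc y Xy; rewrite (metric_sym (f x) (f x0)); lra.
Qed.

Section compactness.
Context {R : realType} {Z : metricType R}.
Implicit Types A : set Z.

Lemma closure_mdist_le A (e : R) :
  (forall x y, A x -> A y -> mdist x y <= e) ->
  forall x y, closure A x -> closure A y -> mdist x y <= e.
Proof.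
move=> Ae x y Ax Ay; apply/ler_addgt0Pl => d d0.
have d20 : 0 < d / 2 by rewrite divr_gt0.
have [x' [Ax']] := Ax _ (nbhsx_ballx x _ d20).
have [y' [Ay']] := Ay _ (nbhsx_ballx y _ d20).
rewrite !ballEmdist/= => yy' xx'; have := Ae _ _ Ax' Ay'.
have := metric_triangle x x' y; have := metric_triangle x' y' y.
rewrite (metric_sym y' y); lra.
Qed.

(* An ultrafilter on A contains one of the covering sets, hence is Cauchy. *)
Lemma closed_covered_compact A : complete_metric Z -> closed A ->
  (forall e : R, 0 < e -> exists (a b : nat) (P : nat -> set Z),
    A `<=` \bigcup_(k in [set k | (a <= k < b)%N]) P k /\
    forall k x y, (a <= k < b)%N -> P k x -> P k y -> mdist x y < e) ->
  compact A.
Proof.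
move=> cZ cA Ae; rewrite compact_ultra => F UF FA.
have cF : cauchy F.
  apply: cauchy_exP => e e0; have [a [b [P [AP Pe]]]] := Ae e e0.
  have {}AP : F (\bigcup_(k in [set k | (a <= k < b)%N]) P k) by exact: filterS FA.
  have [k kab FP] : exists2 k, (a <= k < b)%N & F (P k).
    apply: contrapT => nk.
    have : F (\bigcap_(k in [set k | (a <= k < b)%N]) ~` P k).
      have nF k : (a <= k < b)%N -> F (~` P k).
        move=> kab; have [|//] := in_ultra_setVsetC (P k) UF.
        by move=> FP; exfalso; apply: nk; exists k.
      elim: b nF {AP Pe nk} => [|b ih] nF.
        by apply: filterS filterT => x _ k /=; lia.
      have [ab|ba] := leqP a b; last by apply: filterS filterT => x _ k /=; lia.
      have Fb : F (~` P b) by apply: nF; rewrite ab ltnSn.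
      have nF' k : (a <= k < b)%N -> F (~` P k) by move=> kab; apply: nF; lia.
      apply: filterS (filterI (ih nF') Fb) => x [xP xb] k /= /andP[ak].
      by rewrite ltnS leq_eqVlt => /predU1P[->//|kb]; apply: xP => /=; rewrite ak.
    move=> /(filterI AP)/filter_ex[x [[k kab Pk]]] /(_ k kab); exact.
  have [x Px] := filter_ex FP.
  by exists x; apply: filterS FP => y Py; rewrite ballEmdist/=; exact: Pe Px Py.
have [l Fl] := cZ F _ cF; exists l; split=> //.
apply: cA => B /Fl FB; have [x xP] := filter_ex (filterI FA FB).
by exists x.
Qed.

End compactness.

Lemma groupably_covered_upper_hausdorff_null (R : realType) X :
  (forall h, groupably_covered X h) -> @upper_hausdorff_null R cantor_space X.
Proof.
move=> Xh Y f uf; apply/eqP; rewrite eq_le; apply/andP; split; last first.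
  apply: le_ereal_inf_tmp => _ [Z [i [C [K [_ _ _ _ ->]]]]].
  exact: hausdorff_dim_ge0.
apply/lee_addgt0Pr => s s0; rewrite add0e.
have [c c0 fc] := unif_continuous_bounded uf.
pose Z : metricType R := sup_space Y c0; pose i : Y -> Z := fun y => mdist y.
have isoi x y : (f @` X) x -> (f @` X) y -> mdist (i x) (i y) = mdist x y.
  apply: kuratowski_isometry => _ _ [x' Xx' <-] [y' Xy' <-]; exact: fc.
(* The first bound serves for compactness and for small diameters, the second makes the s-th powers
   summable. *)
pose e k : R := Num.min (2^-1 ^+ k) ((2^-1 ^+ k) `^ s^-1).
have e0 k : 0 < e k by rewrite lt_min powR_gt0 ?exprn_gt0.
have es k : e k `^ s <= 2^-1 ^+ k.
  have -> : 2^-1 ^+ k = ((2^-1 ^+ k) `^ s^-1) `^ s :> R.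
    by rewrite -powRrM mulVf ?gt_eqF// powRr1 ?exprn_ge0.
  apply: ge0_ler_powR; rewrite ?nnegrE ?powR_ge0 ?(ltW (e0 _)) ?(ltW s0)//.
  by rewrite /e ge_min lexx orbT.
have /choice[h hP] := fun k => unif_continuous_agree uf (e0 k).
have [w [g [gi wP]]] := Xh h.
pose A k := (i \o f) @` (X `&` [set x | agree (h k) (w k) x]).
(* Closures in the complete space turn the groups into closed sets, so that K is sigma-compact. *)
pose P k := closure (A k).
have Pe k x y : P k x -> P k y -> mdist x y <= e k.
  apply: closure_mdist_le => _ _ [x' [Xx' wx'] <-] [y' [Xy' wy'] <-].
  rewrite isoi; [|by exists x'|by exists y'].
  apply/ltW/hP => //; exact: agree_trans (agree_sym wx') wy'.
pose B n := \bigcup_(k in [set k | (g n <= k < g n.+1)%N]) P k.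
have Bc n : closed (B n).
  apply: closed_bigcup => [|k _]; last exact: closed_closure.
  apply: (@sub_finite_set _ _ `I_(g n.+1)); last exact: finite_II.
  by move=> k /= /andP[].
pose K := \bigcup_N \bigcap_(n in [set n | (N <= n)%N]) B n.
have AX k : A k `<=` i @` (f @` X).
  by move=> _ [x [Xx _] <-]; exists (f x) => //; exists x.
apply: (@le_trans _ _ (hausdorff_dim K)).
  apply: ereal_inf_lbound; exists Z, i, (closure (i @` (f @` X))), K.
  split=> //.
  - by split=> //; exact: sup_space_complete.
  - exists (fun N => \bigcap_(n in [set n | (N <= n)%N]) B n) => // N.
    apply: closed_covered_compact; first exact: sup_space_complete.
      by apply: closed_bigI => n _; exact: Bc.
    move=> d d0; have [n nd] := half_expn_lt d0.
    pose p := maxn n N; exists (g p), (g p.+1), P; split.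
      by apply: bigcap_inf; rewrite /= /p leq_maxr.
    move=> k x y /andP[gk _] Px Py; apply: le_lt_trans (Pe k x y Px Py) _.
    apply: le_lt_trans nd; rewrite ge_min; apply/orP; left.
    rewrite ler_wiXn2l ?invf_le1 ?ler1n//.
    exact: leq_trans (leq_trans (leq_maxl n N) (incr_ge p gi)) gk.
  - move=> _ [_ [x Xx <-] <-]; have [N NP] := wP x Xx; exists N => // n /NP[k kn wx].
    by exists k => //; apply: subset_closure; exists x.
  - move=> z [N _ /(_ N (leqnn N))[k _ +]]; exact: closureS (AX k) z.
apply: ereal_inf_lbound; exists s => //; split=> //.
apply/eqP; rewrite eq_le; apply/andP; split; last exact: hausdorff_measure_ge0.
apply: ge_ereal_sup => _ [d /= d0 <-]; apply/lee_addgt0Pr => r r0; rewrite add0e.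
have [n] : exists n, 2^-1 ^+ n < Num.min d r / 2.
  by apply: half_expn_lt; rewrite divr_gt0// lt_min d0.
rewrite ltr_pdivlMr// mulrC lt_min => /andP[nd nr].
have n0 : 0 <= 2^-1 ^+ n :> R by rewrite exprn_ge0.
(* The sets [P k] with k at least n cover K, since a point of K lies in some member of every late
   group. *)
apply: (@le_trans _ _ (\sum_(k <oo) diam (P (n + k)%N) `^ s)%E).
  apply: ereal_inf_lbound; exists (fun k => P (n + k)%N) => //=; split.
    move=> z [N _ /(_ (maxn n N) (leq_maxr _ _))[k /= /andP[gk _] Pk]].
    exists (k - n)%N => //; rewrite subnKC//.
    exact: leq_trans (leq_trans (leq_maxl n N) (incr_ge _ gi)) gk.
  move=> k; apply: le_trans (diam_le (ltW (e0 _)) (@Pe _)) _.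
  rewrite lee_fin ge_min; apply/orP; left; rewrite exprD.
  apply: (@le_trans _ _ (2^-1 ^+ n)); last by lra.
  by rewrite ler_piMr// exprn_ile1// invf_le1// ler1n.
apply: lime_le; first by apply: is_cvg_nneseries => k _ _; exact: poweR_ge0.
apply: nearW => N.
apply: (@le_trans _ _ (2 * 2^-1 ^+ n - 2 * 2^-1 ^+ n * 2^-1 ^+ N)%:E).
  elim: N => [|N ih]; first by rewrite big_nil expr0 mulr1 subrr.
  rewrite big_nat_recr//=.
  apply: le_trans (leeD ih (diam_poweR_le s0 (ltW (e0 _)) (@Pe _))) _.
  rewrite -EFinD lee_fin; have := es (n + N)%N; rewrite exprD exprS; lra.
rewrite lee_fin; have : 0 <= 2 * 2^-1 ^+ n * 2^-1 ^+ N :> R.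
  by rewrite !mulr_ge0// exprn_ge0.
lra.
Qed.

(** * Equivalence of the six properties *)

Theorem theorem8p3 (R : realType) (X : set cantor_space) :
  [<-> @upper_hausdorff_null R cantor_space X;
       additive_for meager X;
       additive_for (null_closed_ideal R) X;
       sharply_additive_for meager X;
       sharply_additive_for (null_closed_ideal R) X;
       sharply_null X].
Proof.
have S_meager := @groupably_covered_sharply_meager_additive X.
have S_null := @groupably_covered_sharply_null_closed_additive R X.
have meagerS : additive_for meager X -> forall h, groupably_covered X h.
  by move=> /meager_additive_block_matched/groupably_covered_blocks.
have [_ null_sub _] := @null_closed_ideal_sigma_ideal R.
have nullS := @null_closed_additive_groupably_covered R X.
(* Each property implies the next in cyclic order, always by way of groupable covers. *)
tfae.
- move=> /upper_hausdorff_null_groupably_covered/S_meager.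
  by apply: sharply_additive_for_additive; exact: meager_sub.
- by move=> /meagerS/S_null; exact: sharply_additive_for_additive.
- by move=> /nullS.
- move=> Xm; apply/S_null/meagerS.
  by apply: sharply_additive_for_additive Xm; exact: meager_sub.
- move=> Xn; apply/sharply_meager_additive_sharply_null/S_meager/nullS.
  exact: sharply_additive_for_additive Xn.
- move=> /sharply_null_block_matched/groupably_covered_blocks.
  exact: groupably_covered_upper_hausdorff_null.
Qed.
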